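(* Let $n,m\ge 1$ be integers and let $T\in B(\mathcal H)$ be an $(n,m)$-power D-normal operator, $T\in[(n,m)DN]$. Then there exist a direct sum decomposition $\mathcal H=\mathcal H_1\oplus\mathcal H_0$ of $\mathcal H$ and a corresponding decomposition $T=T|_{\mathcal H_1}\oplus T|_{\mathcal H_0}=T_1\oplus T_0$ of $T$ such that $T$ is similar to the direct sum of a normal operator in $B(\mathcal H_1)$ with a nilpotent operator (of the order of the Drazin index of $T$), and the Drazin inverse $T_d$ is similar to a normal operator.
   Context: $\mathcal H$ is a complex infinite dimensional Hilbert space and $B(\mathcal H)$ is the algebra of bounded linear operators on $\mathcal H$; $[X,Y]=XY-YX$. An operator $T\in B(\mathcal H)$ is Drazin invertible if there is $T_d\in B(\mathcal H)$ (the Drazin inverse) with $[T_d,T]=0$, $T_d^2T=T_d$ and $T^{p+1}T_d=T^p$ for some integer $p\ge1$; the (least such) $p$ is the Drazin index of $T$. If $T$ is invertible, $T_d=T^{-1}$ (and then $\mathcal H_0=\{0\}$ is allowed). For positive integers $n,m$, $T\in[(n,m)DN]$ means that $T$ is Drazin invertible and $[T_d^n,T^{*m}]=0$, where $T^{*m}=(T^* )^m$. An operator $N_0$ is nilpotent of order $p$ ($p$-nilpotent) when $N_0^p=0$. *)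

(* Defs.v *)
From HB Require Import structures.
From mathcomp Require Import all_boot all_order all_algebra.
From mathcomp Require Import complex.
From mathcomp Require Import all_classical all_reals all_analysis.

Set Implicit Arguments.
Unset Strict Implicit.
Unset Printing Implicit Defensive.

Import Order.TTheory GRing.Theory Num.Theory.
Import numFieldNormedType.Exports.

Local Open Scope classical_set_scope.
Local Open Scope ring_scope.

(* The inner product is linear in its first argument and conjugate-linear in
   the second; the norm takes its (real) values in R[i]. *)
HB.mixin Record CompleteNormedModule_isHilbert (R : realType) H
    of CompleteNormedModule R[i] H := {
  inner : {dot H for @Num.conj R[i]};
  inner_normE : forall x : H, inner x x = `|x| ^+ 2 }.

#[short(type="hilbertType")]
HB.structure Definition Hilbert (R : realType) :=
  { H of CompleteNormedModule_isHilbert R H & CompleteNormedModule R[i] H }.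

Definition infinite_dimensional (R : realType) (H : hilbertType R) : Prop :=
  forall (k : nat) (v : 'I_k -> H),
    exists x : H, forall c : 'I_k -> R[i], x <> \sum_(i < k) c i *: v i.

(* For linear maps this boundedness is continuity: linear_bounded_continuous. *)
Record bounded_op (R : realType) (H : hilbertType R) := BoundedOp {
  bop_fun :> {linear H -> H};
  bop_bounded : bounded_near bop_fun (nbhs (0 : H)) }.

Section Operators.
Context {R : realType} {H : hilbertType R}.
Implicit Types (V W : set H) (T S N : bounded_op H) (p q n m : nat).

Definition closed_subspace V : Prop :=
  [/\ closed V, V 0 & forall (a : R[i]) x y, V x -> V y -> V (a *: x + y)].

(* H = V (+) W as a topological direct sum; it need not be orthogonal. *)
Definition direct_sum_decomposition V W : Prop :=
  [/\ closed_subspace V, closed_subspace W, V `&` W = [set 0]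
    & forall x : H, exists v w, [/\ V v, W w & x = v + w]].

Definition invariant V T : Prop := forall x, V x -> V (T x).

(* T = T|_V (+) T|_W *)
Definition decomposes V W T : Prop := invariant V T /\ invariant W T.

(* A' is the adjoint, in B(V), of the restriction of A to V. Such an A' is
   unique on V, and is automatically linear and bounded there. *)
Definition adjoint_on V (A A' : H -> H) : Prop :=
  (forall y, V y -> V (A' y)) /\
  (forall x y, V x -> V y -> inner (A x) y = inner x (A' y)).

Definition is_adjoint T S : Prop := adjoint_on setT T S.

(* For V a closed subspace invariant under N: N|_V is normal in B(V). *)
Definition normal_on V N : Prop :=
  exists N' : H -> H, adjoint_on V N N' /\
    forall x, V x -> N (N' x) = N' (N x).

Definition normal_op N : Prop :=
  exists N' : bounded_op H, is_adjoint N N' /\ forall x, N (N' x) = N' (N x).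

Definition nilpotent_on V p N : Prop := forall x, V x -> iter p N x = 0.

Definition similar_op T S : Prop :=
  exists X Y : bounded_op H,
    [/\ forall x, X (Y x) = x, forall x, Y (X x) = x
      & forall x, X (T x) = S (X x)].

Definition drazin_spec p T S : Prop :=
  [/\ (1 <= p)%N, forall x, S (T x) = T (S x), forall x, S (S (T x)) = S x
    & forall x, iter p.+1 T (S x) = iter p T x].

Definition drazin_inverse T S : Prop := exists p, drazin_spec p T S.

Definition drazin_index T p : Prop :=
  (exists S, drazin_spec p T S) /\ (forall q S, drazin_spec q T S -> (p <= q)%N).

(* T is in [(n,m)DN]. Drazin inverse and adjoint are both unique, and the
   adjoint always exists. *)
Definition power_D_normal n m T : Prop :=
  exists Td Ts : bounded_op H,
    [/\ drazin_inverse T Td, is_adjoint T Ts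
      & forall x, iter n Td (iter m Ts x) = iter m Ts (iter n Td x)].

End Operators.

(* Main.v *)
Require Import Defs.
From HB Require Import structures.
From mathcomp Require Import all_boot all_order all_algebra.
From mathcomp Require Import cyclic separable cyclotomic complex.
From mathcomp Require Import all_classical all_reals all_analysis.
From mathcomp Require Import ring lra.

(* Put k = n m, G = T_d^k and let P = T T_d.  Since T_d^n commutes with T*^m,
   G commutes with T*^k, hence with its Drazin inverse G*: G is normal.  Normal
   operators have the kernel of their adjoint, so the idempotent P, which has
   the kernel and the range of G, is an orthogonal projection.  On the range of
   P the operator T is invertible and T^k is normal, and the theorem reduces to:
   an invertible operator T with T^k normal is similar to a normal one, through
   an X commuting with everything that commutes with T and T*.
   By Fuglede's theorem T commutes with |T^k|, hence with F = |T^k|^(1/k).  The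
   operator U = F^-1 T satisfies U*^k U^k = 1, so U* Q U = Q for
   Q = \sum_(j < k) U*^j U^j, and with X = Q^(1/2) the operator X U X^-1 is
   unitary and commutes with F.
   Fuglede's theorem: let S commute with the normal A and put D S = A* S - S A*.
   As |q(A)* S x| <= |S| |q(A)* x| for polynomials q, one gets
   |S + e D S| <= |S| (1 + O(|e|^2)) for complex e; iterating n times with
   |e| = z / n, n -> oo, and extracting the coefficient of e bounds |z D S| by a
   constant, for all z > 0. *)

Set Implicit Arguments.
Unset Strict Implicit.
Unset Printing Implicit Defensive.

Import Order.TTheory GRing.Theory Num.Theory.
Import numFieldNormedType.Exports.
Import ComplexField.Normc.

Local Open Scope classical_set_scope.
Local Open Scope ring_scope.

(** * Real-valued norm, inner product and completeness of [H] *)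

Section HilbertNorm.
Context {R : realType} {H : hilbertType R}.
Implicit Types (x y z : H) (a b : R[i]).

(* The library norm of H lives in R[i]; estimates are made in R. *)
Definition hnorm x : R := complex.Re `|x|.

Lemma hnormE x : `|x| = (hnorm x)%:C%C.
Proof. by rewrite /hnorm RRe_real// normr_real. Qed.

Lemma hnorm_ge0 x : 0 <= hnorm x.
Proof. by rewrite -ler0c -hnormE. Qed.

Lemma hnorm0 : hnorm 0 = 0.
Proof. by rewrite /hnorm normr0. Qed.

Lemma hnorm_eq0 x : hnorm x = 0 -> x = 0.
Proof. by move=> h; apply/eqP; rewrite -normr_eq0 hnormE h. Qed.

Lemma hnormN x : hnorm (- x) = hnorm x.
Proof. by rewrite /hnorm normrN. Qed.

Lemma hnormD x y : hnorm (x + y) <= hnorm x + hnorm y.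
Proof. by rewrite -lecR rmorphD/= -!hnormE ler_normD. Qed.

Lemma hnormB x y : hnorm (x - y) <= hnorm x + hnorm y.
Proof. by rewrite -(hnormN y) hnormD. Qed.

Lemma hnormZ a x : hnorm (a *: x) = normc a * hnorm x.
Proof. by apply: complexI; rewrite rmorphM/= -!hnormE normrZ. Qed.

Lemma ipDl x y z : inner (x + y) z = inner x z + inner y z.
Proof. exact: linearDl. Qed.

Lemma ipZl a x z : inner (a *: x) z = a * inner x z.
Proof. by rewrite linearZl_LR. Qed.

Lemma ip0l x : inner 0 x = 0 :> R[i].
Proof. exact: linear0l. Qed.

Lemma ipC x y : inner x y = (inner y x)^*.
Proof. by rewrite hermC/= expr0 mul1r. Qed.

Lemma ipDr x y z : inner x (y + z) = inner x y + inner x z.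
Proof. exact: linearDr. Qed.

Lemma ipBr x y z : inner x (y - z) = inner x y - inner x z.
Proof. exact: linearBr. Qed.

Lemma ipZr a x z : inner x (a *: z) = a^* * inner x z.
Proof. by rewrite linearZr_LR. Qed.

Lemma ip0r x : inner x 0 = 0 :> R[i].
Proof. exact: linear0r. Qed.

Lemma ipxx x : inner x x = (hnorm x ^+ 2)%:C%C.
Proof. by rewrite inner_normE hnormE rmorphXn. Qed.

(** A real inner product with the same norm: identities between squared norms become identities in
    [R], within reach of [ring] and [lra]. *)
Definition rip x y : R := complex.Re (inner x y).

Lemma ReD a b : complex.Re (a + b) = complex.Re a + complex.Re b.
Proof. by case: a b => [? ?] [? ?]. Qed.

Lemma ReN a : complex.Re (- a) = - complex.Re a.
Proof. by case: a. Qed.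

Lemma ReZ (t : R) a : complex.Re (t%:C%C * a) = t * complex.Re a.
Proof. by case: a => u v /=; rewrite mul0r subr0. Qed.

Lemma Re_conj a : complex.Re a^* = complex.Re a.
Proof. by case: a. Qed.

Lemma ripC x y : rip x y = rip y x.
Proof. by rewrite /rip ipC Re_conj. Qed.

Lemma ripDl x y z : rip (x + y) z = rip x z + rip y z.
Proof. by rewrite /rip ipDl ReD. Qed.

Lemma ripNl x z : rip (- x) z = - rip x z.
Proof. by rewrite -ReN /rip -scaleN1r ipZl mulN1r. Qed.

Lemma ripZl (t : R) x z : rip (t%:C%C *: x) z = t * rip x z.
Proof. by rewrite /rip ipZl ReZ. Qed.

Lemma ripDr x y z : rip z (x + y) = rip z x + rip z y.
Proof. by rewrite ![rip z _]ripC ripDl. Qed.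

Lemma ripNr x z : rip z (- x) = - rip z x.
Proof. by rewrite ![rip z _]ripC ripNl. Qed.

Lemma ripZr (t : R) x z : rip z (t%:C%C *: x) = t * rip z x.
Proof. by rewrite ![rip z _]ripC ripZl. Qed.

Lemma ripxx x : rip x x = hnorm x ^+ 2.
Proof. by rewrite /rip ipxx. Qed.

Lemma hnorm_sqD x y : hnorm (x + y) ^+ 2 = hnorm x ^+ 2 + 2 * rip x y + hnorm y ^+ 2.
Proof. by rewrite -!ripxx ripDl !ripDr (ripC y x); ring. Qed.

Lemma hnorm_sqB x y : hnorm (x - y) ^+ 2 = hnorm x ^+ 2 - 2 * rip x y + hnorm y ^+ 2.
Proof. by rewrite hnorm_sqD ripNr hnormN; ring. Qed.

(** Squaring the triangle inequality leaves exactly Cauchy-Schwarz for the real part. *)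
Lemma rip_le x y : rip x y <= hnorm x * hnorm y.
Proof.
have := hnormD x y; rewrite -ler_sqr ?nnegrE ?addr_ge0 ?hnorm_ge0// hnorm_sqD.
by rewrite sqrrD -mulr_natl; lra.
Qed.

Lemma normc_ip_le x y : normc (inner x y) <= hnorm x * hnorm y.
Proof.
set c := inner x y; have [c0|c0] := eqVneq c 0.
  by rewrite c0 normc0 mulr_ge0 ?hnorm_ge0.
have n0 : 0 < normc c by rewrite -ltcR; change (0 < `|c|); rewrite normr_gt0.
(* Turning [x] by the conjugate of [c] makes the inner product the real number |c|^2. *)
have := rip_le (c^* *: x) y.
rewrite /rip ipZl -/c hnormZ mulrC -normCK.
have -> : `|c| = (normc c)%:C%C by [].
rewrite -rmorphXn /= expr2.
have -> : normc c^* = normc c by apply: complexI; exact: norm_conjC.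
by rewrite -mulrA ler_pM2l.
Qed.

Lemma ip_eq x y : (forall z, inner z x = inner z y) -> x = y.
Proof.
move=> h; apply/subr0_eq/hnorm_eq0/eqP; rewrite -sqrf_eq0 -ripxx /rip.
by rewrite ipBr h subrr.
Qed.

Lemma hnorm_small_eq x y (e : nat -> R) :
  e @ \oo --> 0 -> (forall n, hnorm (x - y) <= e n) -> x = y.
Proof.
move=> e0 le_e; apply/subr0_eq/hnorm_eq0/eqP; rewrite eq_le hnorm_ge0 andbT.
rewrite -(cvg_lim _ e0)//; apply: limr_ge; first by apply/cvg_ex; exists 0.
exact: nearW.
Qed.

(** The limit keeps the explicit rate [e]; for operators this gives estimates uniform in the
    vector. *)
Lemma hnorm_complete (u : nat -> H) (e : nat -> R) : e @ \oo --> 0 ->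
  (forall m n, (m <= n)%N -> hnorm (u n - u m) <= e m) ->
  exists l, forall n, hnorm (l - u n) <= e n.
Proof.
move=> e0 ue.
have ucv : cvg (u @ \oo).
  apply/cauchy_cvgP/cauchy_ballP => d d0; near_simpl.
  have dR : d = (complex.Re d)%:C%C by rewrite RRe_real// gtr0_real.
  have d'0 : 0 < complex.Re d by rewrite -ltcR -dR.
  have : \forall n \near \oo, e n < complex.Re d / 2.
    by apply: (cvgr_lt 0 e0); rewrite divr_gt0.
  move=> [N _ eN].
  exists ([set n | (N <= n)%N], [set n | (N <= n)%N]) => /=.
    by split; exists N.
  move=> [m n] [/= Nm Nn].
  rewrite -ball_normE /ball_/= hnormE dR ltcR.
  have -> : u m - u n = (u m - u N) - (u n - u N) by rewrite opprB addrA subrK.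
  apply: le_lt_trans (hnormB _ _) _.
  have := ue _ _ Nm; have := ue _ _ Nn; have := eN N (leqnn N) => /=; lra.
exists (lim (u @ \oo)) => n.
apply/ler_addgt0Pr => d d0.
have /cvgrPdist_lt /(_ d%:C%C) := ucv.
rewrite ltcR => /(_ d0) [N _ dN].
have := dN (maxn N n) (leq_maxl _ _) => /=; rewrite hnormE ltcR => h1.
have h2 := ue _ _ (leq_maxr N n).
have -> : lim (u @ \oo) - u n
  = (lim (u @ \oo) - u (maxn N n)) + (u (maxn N n) - u n).
  by rewrite addrA subrK.
apply: le_trans (hnormD _ _) _; rewrite addrC; apply: lerD => //; exact: ltW.
Unshelve. all: by end_near. Qed.

End HilbertNorm.

(** * Bounded operators as a complete algebra *)

Section BoundedOperators.
Context {R : realType} {H : hilbertType R}.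
Implicit Types (x y z : H) (a b : R[i]) (A B C : bounded_op H).

Lemma bounded_nearE (f : {linear H -> H}) : bounded_near f (nbhs (0 : H)) <->
  exists M : R, forall x, hnorm (f x) <= M * hnorm x.
Proof.
rewrite linear_boundedP; split.
  move=> /pinfty_ex_gt0 [r r0 fr]; exists (complex.Re r) => x.
  by have := fr x; rewrite !hnormE -{1}(RRe_real (gtr0_real r0)) -rmorphM lecR.
move=> [M fM]; exists M%:C%C; split.
  by apply/complex_realP; exists M.
move=> r Mr x; rewrite !hnormE.
(* Comparable elements of [R[i]] differ by a real number, so a bound above [M] is real. *)
have rR : r = (complex.Re r)%:C%C.
  by rewrite RRe_real// (ger_real (ltW Mr)); apply/complex_realP; exists M.
rewrite rR -rmorphM lecR (le_trans (fM x))// ler_wpM2r ?hnorm_ge0//.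
by move: Mr; rewrite rR ltcR => /ltW.
Qed.

Lemma bop_ext A B : (forall x, A x = B x) -> A = B.
Proof.
case: A B => [f fb] [g gb] /= fg.
(* Equal functions carry equal linear structures, since these differ only in proofs. *)
have fgE : f = g.
  case: f g fg {fb gb} => [f fc] [g gc] /= /funext fg.
  by case: g / fg gc => gc; congr GRing.Linear.Pack; move: fc gc => [[a] [b]] [[c] [d]];
    congr GRing.Linear.Class; congr (_ _); exact: Prop_irrelevance.
by case: g / fgE gb {fg} => gb; congr BoundedOp; exact: Prop_irrelevance.
Qed.

(** A constant of at least 1 can serve both as a divisor and as a nonnegative factor. *)
Lemma bop_bound A : exists M : R, 1 <= M /\ forall x, hnorm (A x) <= M * hnorm x.
Proof.
have [M AM] := (bounded_nearE _).1 (bop_bounded A).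
exists (Num.max 1 M); split => [|x]; first by rewrite le_max lexx.
by rewrite (le_trans (AM x))// ler_wpM2r ?hnorm_ge0// le_max lexx orbT.
Qed.

Section Make.
Variables (f : H -> H) (f_lin : linear f).
Hypothesis f_bd : exists M : R, forall x, hnorm (f x) <= M * hnorm x.

Let g : H -> H := f.
HB.instance Definition _ := GRing.isLinear.Build R[i] H H *:%R g f_lin.

Definition mk_bop : bounded_op H :=
  @BoundedOp _ _ (g : {linear H -> H}) ((bounded_nearE g).2 f_bd).

Lemma mk_bopE x : mk_bop x = f x. Proof. by []. Qed.
End Make.

Lemma bop0_sub : exists M : R, forall x, hnorm (0 : H) <= M * hnorm x.
Proof. by exists 0 => x; rewrite mul0r hnorm0. Qed.

Lemma bop1_sub : exists M : R, forall x, hnorm x <= M * hnorm x.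
Proof. by exists 1 => x; rewrite mul1r. Qed.

Lemma bopN_sub A : exists M : R, forall x, hnorm (- A x) <= M * hnorm x.
Proof. by have [M [_ AM]] := bop_bound A; exists M => x; rewrite hnormN. Qed.

Lemma bopD_sub A B : exists M : R, forall x, hnorm (A x + B x) <= M * hnorm x.
Proof.
have [M [_ AM]] := bop_bound A; have [N [_ BN]] := bop_bound B.
by exists (M + N) => x; rewrite (le_trans (hnormD _ _))// mulrDl lerD.
Qed.

Lemma bopM_sub A B : exists M : R, forall x, hnorm (A (B x)) <= M * hnorm x.
Proof.
have [M [M1 AM]] := bop_bound A; have [N [_ BN]] := bop_bound B.
exists (M * N) => x; rewrite (le_trans (AM _))// -mulrA ler_wpM2l//.
exact: le_trans M1.
Qed.

Lemma bopZ_sub a A : exists M : R, forall x, hnorm (a *: A x) <= M * hnorm x.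
Proof.
have [M [_ AM]] := bop_bound A; exists (normc a * M) => x.
by rewrite hnormZ -mulrA ler_wpM2l// -lecR; exact: (normr_ge0 a).
Qed.

Lemma bop0_lin : linear (fun _ : H => 0 : H).
Proof. by move=> a x y; rewrite scaler0 addr0. Qed.

Lemma bop1_lin : linear (fun x : H => x).
Proof. by []. Qed.

Lemma bopN_lin A : linear (fun x => - A x).
Proof. by move=> a x y; rewrite linearP opprD scalerN. Qed.

Lemma bopD_lin A B : linear (fun x => A x + B x).
Proof. by move=> a x y; rewrite !linearP scalerDr addrACA. Qed.

Lemma bopM_lin A B : linear (fun x => A (B x)).
Proof. by move=> a x y; rewrite !linearP. Qed.

Lemma bopZ_lin b A : linear (fun x => b *: A x).
Proof. by move=> a x y; rewrite (linearP A) scalerDr !scalerA mulrC. Qed.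

Definition bop0 := mk_bop bop0_lin bop0_sub.
Definition bop1 := mk_bop bop1_lin bop1_sub.
Definition bopN A := mk_bop (bopN_lin A) (bopN_sub A).
Definition bopD A B := mk_bop (bopD_lin A B) (bopD_sub A B).
Definition bopM A B := mk_bop (bopM_lin A B) (bopM_sub A B).
Definition bopZ a A := mk_bop (bopZ_lin a A) (bopZ_sub a A).

Lemma bopDA : associative bopD.
Proof. by move=> A B C; apply: bop_ext => x /=; rewrite addrA. Qed.
Lemma bopDC : commutative bopD.
Proof. by move=> A B; apply: bop_ext => x /=; rewrite addrC. Qed.
Lemma bop0D : left_id bop0 bopD.
Proof. by move=> A; apply: bop_ext => x /=; rewrite add0r. Qed.
Lemma bopND : left_inverse bop0 bopN bopD.
Proof. by move=> A; apply: bop_ext => x /=; rewrite addNr. Qed.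

HB.instance Definition _ := gen_eqMixin (bounded_op H).
HB.instance Definition _ := gen_choiceMixin (bounded_op H).
HB.instance Definition _ :=
  GRing.isZmodule.Build (bounded_op H) bopDA bopDC bop0D bopND.

Lemma bopMA : associative bopM.
Proof. by move=> A B C; apply: bop_ext. Qed.
Lemma bop1M : left_id bop1 bopM.
Proof. by move=> A; apply: bop_ext. Qed.
Lemma bopM1 : right_id bop1 bopM.
Proof. by move=> A; apply: bop_ext. Qed.
Lemma bopMDl : left_distributive bopM +%R.
Proof. by move=> A B C; apply: bop_ext. Qed.
Lemma bopMDr : right_distributive bopM +%R.
Proof. by move=> A B C; apply: bop_ext => x /=; rewrite linearD. Qed.

(** A possibly trivial ring: [1 = 0] when [H] is zero. *)
HB.instance Definition _ :=
  GRing.Zmodule_isPzRing.Build (bounded_op H) bopMA bop1M bopM1 bopMDl bopMDr.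

Lemma bopZA a b A : bopZ a (bopZ b A) = bopZ (a * b) A.
Proof. by apply: bop_ext => x /=; rewrite scalerA. Qed.
Lemma bop1Z : left_id 1 bopZ.
Proof. by move=> A; apply: bop_ext => x /=; rewrite scale1r. Qed.
Lemma bopZDr : right_distributive bopZ +%R.
Proof. by move=> a A B; apply: bop_ext => x /=; rewrite scalerDr. Qed.
Lemma bopZDl A : {morph bopZ^~ A : a b / a + b}.
Proof. by move=> a b; apply: bop_ext => x /=; rewrite scalerDl. Qed.

HB.instance Definition _ :=
  GRing.Zmodule_isLmodule.Build R[i] (bounded_op H) bopZA bop1Z bopZDr bopZDl.

Lemma bop0E x : (0 : bounded_op H) x = 0. Proof. by []. Qed.
Lemma bop1E x : (1 : bounded_op H) x = x. Proof. by []. Qed.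
Lemma bopNE A x : (- A) x = - A x. Proof. by []. Qed.
Lemma bopDE A B x : (A + B) x = A x + B x. Proof. by []. Qed.
Lemma bopBE A B x : (A - B) x = A x - B x. Proof. by []. Qed.
Lemma bopME A B x : (A * B) x = A (B x). Proof. by []. Qed.
Lemma bopZE a A x : (a *: A) x = a *: A x. Proof. by []. Qed.

Lemma bopXE A n x : (A ^+ n) x = iter n A x.
Proof. by elim: n x => [//|n IH] x; rewrite exprS bopME IH. Qed.

Lemma bop_sumE I (r : seq I) (F : I -> bounded_op H) x :
  (\sum_(i <- r) F i) x = \sum_(i <- r) F i x.
Proof. by elim/big_rec2: _ => // i y A _ <-. Qed.

Lemma bopZAl a A B : a *: (A * B) = (a *: A) * B.
Proof. exact: bop_ext. Qed.
Lemma bopZAr a A B : a *: (A * B) = A * (a *: B).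
Proof. by apply: bop_ext => x; rewrite !(bopZE, bopME) linearZ. Qed.

Lemma comm_bopZ a A B : GRing.comm A B -> GRing.comm A (a *: B).
Proof. by move=> AB; rewrite /GRing.comm -bopZAr -bopZAl AB. Qed.

Lemma bopZX a A n : (a *: A) ^+ n = a ^+ n *: A ^+ n.
Proof.
elim: n => [|n IH]; first by rewrite !expr0 scale1r.
by rewrite !exprS IH -bopZAl -bopZAr scalerA.
Qed.

(** Upper bounds of the operator norm stand in for the norm itself, so that no supremum has to be
    handled. *)
Definition opbd A (M : R) := forall x, hnorm (A x) <= M * hnorm x.

Lemma opbdW A M N : M <= N -> opbd A M -> opbd A N.
Proof. by move=> MN AM x; rewrite (le_trans (AM x))// ler_wpM2r ?hnorm_ge0. Qed.

Lemma opbd0 : opbd 0 0.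
Proof. by move=> x; rewrite hnorm0 mul0r. Qed.

Lemma opbd1 : opbd 1 1.
Proof. by move=> x; rewrite mul1r. Qed.

Lemma opbdN A M : opbd A M -> opbd (- A) M.
Proof. by move=> AM x; rewrite bopNE hnormN. Qed.

Lemma opbdD A B M N : opbd A M -> opbd B N -> opbd (A + B) (M + N).
Proof. by move=> AM BN x; rewrite bopDE (le_trans (hnormD _ _))// mulrDl lerD. Qed.

Lemma opbdM A B M N : 0 <= M -> opbd A M -> opbd B N -> opbd (A * B) (M * N).
Proof.
by move=> M0 AM BN x; rewrite (le_trans (AM _))// -mulrA ler_wpM2l.
Qed.

Lemma opbdX A M n : 0 <= M -> opbd A M -> opbd (A ^+ n) (M ^+ n).
Proof.
move=> M0 AM; elim: n => [|n IH]; first exact: opbd1.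
by rewrite !exprS; exact: opbdM.
Qed.

Lemma normc_ge0 a : 0 <= normc a.
Proof. by rewrite -lecR; exact: (normr_ge0 a). Qed.

Lemma opbdZ a A M : opbd A M -> opbd (a *: A) (normc a * M).
Proof. by move=> AM x; rewrite hnormZ -mulrA ler_wpM2l ?normc_ge0. Qed.

Lemma opbd_sum I (r : seq I) (F : I -> bounded_op H) (M : I -> R) :
  (forall i, opbd (F i) (M i)) -> opbd (\sum_(i <- r) F i) (\sum_(i <- r) M i).
Proof.
by move=> FM; elim/big_rec2: _ => [|i A m _]; [exact: opbd0|exact: opbdD].
Qed.

Lemma bop_ext_lim A B (e : nat -> R) : e @ \oo --> 0 ->
  (forall n, opbd (A - B) (e n)) -> A = B.
Proof.
move=> e0 ABe; apply: bop_ext => x.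
apply: (@hnorm_small_eq _ _ _ _ (fun n => e n * hnorm x)).
  by rewrite -[X in _ --> X](mul0r (hnorm x)); apply: cvgM => //; exact: cvg_cst.
by move=> n; exact: ABe.
Qed.

(** Linearity passes to pointwise limits, and the rate, uniform in the vector, gives boundedness and
    convergence in norm. *)
Lemma bop_complete (A : nat -> bounded_op H) (e : nat -> R) : e @ \oo --> 0 ->
  (forall m n, (m <= n)%N -> opbd (A n - A m) (e m)) ->
  exists L : bounded_op H, forall n, opbd (L - A n) (e n).
Proof.
move=> e0 Ae.
have ex0 x : (fun n => e n * hnorm x) @ \oo --> (0 : R).
  by rewrite -[X in _ --> X](mul0r (hnorm x)); apply: cvgM => //; exact: cvg_cst.
have /choice[f fP] x : exists l, forall n, hnorm (l - A n x) <= e n * hnorm x.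
  by apply: hnorm_complete => // m n mn; exact: Ae.
have f_lin : linear f.
  move=> a x y.
  apply: (@hnorm_small_eq _ _ _ _ (fun n => e n * hnorm (a *: x + y) +
    (normc a * (e n * hnorm x) + e n * hnorm y))).
    rewrite -[X in _ --> X](addr0 0); apply: cvgD => //.
    rewrite -[X in _ --> X](addr0 0); apply: cvgD => //.
    by rewrite -[X in _ --> X](mulr0 (normc a)); apply: cvgM => //; exact: cvg_cst.
  move=> n.
  have -> : f (a *: x + y) - (a *: f x + f y) = (f (a *: x + y) - A n (a *: x + y))
      - (a *: (f x - A n x) + (f y - A n y)).
    rewrite linearP scalerBr addrACA -opprD opprB.
    by rewrite [LHS]/(_ - _) addrA subrK.
  rewrite (le_trans (hnormB _ _))// lerD// (le_trans (hnormD _ _))// lerD//.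
  by rewrite hnormZ ler_wpM2l// normc_ge0.
have f_bd : exists M : R, forall x, hnorm (f x) <= M * hnorm x.
  have [M [_ AM]] := bop_bound (A 0%N).
  exists (e 0%N + M) => x; rewrite -[f x](subrK (A 0%N x)) mulrDl.
  by rewrite (le_trans (hnormD _ _))// lerD.
by exists (mk_bop f_lin f_bd) => n x; exact: fP.
Qed.

End BoundedOperators.

(** * The Riesz representation theorem *)

Section Riesz.
Context {R : realType} {H : hilbertType R}.
Variables (f : H -> R[i]) (M : R).
Hypotheses (f_lin : forall (a : R[i]) x y, f (a *: x + y) = a * f x + f y)
  (f_bd : forall x, normc (f x) <= M * hnorm x).

Let phi x := complex.Re (f x).
(** If [y] represents [f], then [J x] is |x - y|^2 - |y|^2; the representing vector is therefore
    sought as the minimiser of [J]. *)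
Let J x := hnorm x ^+ 2 - 2 * phi x.
Let s n : R := n.+1%:R^-1.

Let s_gt0 n : 0 < s n. Proof. by rewrite invr_gt0. Qed.

Let fD x y : f (x + y) = f x + f y.
Proof. by rewrite -[x]scale1r f_lin mul1r scale1r. Qed.

Let f0 : f 0 = 0.
Proof. by have := fD 0 0; rewrite addr0 -{1}[f 0]addr0 => /addrI. Qed.

Let fZ a x : f (a *: x) = a * f x.
Proof. by rewrite -[a *: x]addr0 f_lin f0 addr0. Qed.

Let phi_le x : phi x <= M * hnorm x.
Proof.
apply: le_trans (f_bd x); apply: le_trans (ler_norm _) _.
by rewrite -lecR; exact: normc_ge_Re.
Qed.

Let J_ge x : - M ^+ 2 <= J x.
Proof.
have := phi_le x; have : 0 <= (hnorm x - M) ^+ 2 by exact: sqr_ge0.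
by rewrite /J; nra.
Qed.

Let inf_lbJ : has_inf (range J).
Proof. by split; [exists (J 0), 0 | exists (- M ^+ 2) => _ [x _ <-]; exact: J_ge]. Qed.

Let m := inf (range J).

Let J_inf x : m <= J x.
Proof. by apply: (ge_inf inf_lbJ.2); exists x. Qed.

(* J is strictly convex, so a minimising sequence is a Cauchy sequence. *)
Let J_mid x y (d : R) : J x <= m + d ^+ 2 -> J y <= m + d ^+ 2 -> 0 <= d ->
  hnorm (x - y) <= 2 * d.
Proof.
move=> Jx Jy d0; have := J_inf (2^-1%:C%C *: (x + y)).
have : J (2^-1%:C%C *: (x + y)) =
    (J x + J y) / 2 - hnorm (x - y) ^+ 2 / 4.
  rewrite /J -!ripxx ripZl ripZr /phi fZ ReZ fD ReD.
  by rewrite !(ripDl, ripDr, ripNl, ripNr) (ripC y x); field.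
move=> -> le_m; rewrite -ler_sqr ?nnegrE ?hnorm_ge0 ?mulr_ge0//.
by rewrite exprMn; lra.
Qed.

(** Euler equation at an approximate minimiser: the steps [t = s n] and [t = - s n] balance the
    defect [s n ^+ 2] against the quadratic term, so the equation holds up to O(s n). *)
Let phi_lim u y : (forall n, J (u n) <= m + s n ^+ 2) ->
  (forall n, hnorm (y - u n) <= 2 * s n) -> forall h, phi h = rip h y.
Proof.
move=> Ju yu h.
have Jd n (t : R) : 0 <= s n ^+ 2 + 2 * t * (rip h (u n) - phi h) + t ^+ 2 * hnorm h ^+ 2.
  have := J_inf (u n + t%:C%C *: h); have := Ju n.
  rewrite /J hnorm_sqD ripZr /phi fD fZ ReD ReZ -!ripxx ripZl ripZr (ripC (u n) h).
  by lra.
have h1 n : `|rip h (u n) - phi h| <= s n * (hnorm h ^+ 2 + 1) / 2.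
  have sn := s_gt0 n; set d := rip _ _ - _.
  have := Jd n (s n); have := Jd n (- s n); rewrite -/d => h1 h2.
  have {}h1 : 0 <= s n * (s n - 2 * d + s n * hnorm h ^+ 2).
    by rewrite (le_trans h1)// le_eqVlt; apply/orP; left; apply/eqP; ring.
  have {}h2 : 0 <= s n * (s n + 2 * d + s n * hnorm h ^+ 2).
    by rewrite (le_trans h2)// le_eqVlt; apply/orP; left; apply/eqP; ring.
  by move: h1 h2; rewrite !pmulr_rge0// ler_norml => h1 h2; apply/andP; split; lra.
have h2 n : `|rip h y - phi h| <= s n * ((hnorm h ^+ 2 + 1) / 2 + 2 * hnorm h).
  have -> : rip h y - phi h = (rip h (u n) - phi h) + rip h (y - u n).
    by rewrite ripDr ripNr; ring.
  rewrite mulrDr mulrA (le_trans (ler_normD _ _))// lerD//.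
  have h3 : hnorm h * hnorm (y - u n) <= s n * (2 * hnorm h).
    apply: le_trans (ler_wpM2l (hnorm_ge0 h) (yu n)) _.
    by rewrite le_eqVlt; apply/orP; left; apply/eqP; ring.
  rewrite ler_norml (le_trans (rip_le _ _) h3) andbT lerNl.
  by rewrite -ripNr (le_trans (rip_le _ _))// hnormN.
apply/esym/subr0_eq/eqP; rewrite -normr_eq0 eq_le normr_ge0 andbT.
set c := (hnorm h ^+ 2 + 1) / 2 + 2 * hnorm h in h2 *.
have c0 : (fun n => s n * c) @ \oo --> (0 : R).
  rewrite -[X in _ --> X](mul0r c); apply: cvgM; last exact: cvg_cst.
  exact: cvg_harmonic.
rewrite -(cvg_lim _ c0)//; apply: limr_ge; first by apply/cvg_ex; exists 0.
exact: nearW.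
Qed.

Lemma riesz : exists y, forall x, f x = inner x y.
Proof.
have /choice[u Ju] n : exists x, J x <= m + s n ^+ 2.
  have sn : 0 < s n ^+ 2 by rewrite exprn_gt0.
  by have [_ [x _ <-] /ltW Jx] := inf_adherent sn inf_lbJ; exists x.
have s_mono k n : (k <= n)%N -> s n <= s k.
  by move=> kn; rewrite /s lef_pV2 ?posrE ?ltr0n// ler_nat ltnS.
have [y yu] : exists y, forall n, hnorm (y - u n) <= 2 * s n.
  apply: hnorm_complete.
    rewrite -[X in _ --> X](mulr0 2); apply: cvgM; first exact: cvg_cst.
    exact: cvg_harmonic.
  move=> k n kn; apply: J_mid (Ju k) (ltW (s_gt0 k)).
  by rewrite (le_trans (Ju n))// lerD2l ler_sqr ?nnegrE ?(ltW (s_gt0 _)) ?s_mono.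
have phiE := phi_lim Ju yu.
exists y => x.
(* The real parts at [x] and at [i x] give the real and imaginary parts of [f x]. *)
have h1 := phiE x; have := phiE ('i%C *: x).
rewrite /phi /rip ipZl fZ in h1 * => h2.
case: (f x) (inner x y) h1 h2 => [a b] [c d] /= -> .
by rewrite !mul0r !mul1r !sub0r => /oppr_inj ->.
Qed.

End Riesz.

(** * Adjoints *)

Section Adjoint.
Context {R : realType} {H : hilbertType R}.
Implicit Types (x y z : H) (a b : R[i]) (A B C : bounded_op H).

(** Riesz gives [B y] from the functional [x |-> inner (A x) y]; pairing [B y] with itself bounds
    it. *)
Lemma adj_subproof A : exists B, forall x y, inner (A x) y = inner x (B y).
Proof.
have [M [M1 AM]] := bop_bound A; have M0 : 0 <= M by exact: le_trans M1.
have /choice[f fP] y : exists z, forall x, inner (A x) y = inner x z.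
  apply: (@riesz _ _ _ (M * hnorm y)) => [a x x'|x].
    by rewrite linearP ipDl ipZl.
  rewrite (le_trans (normc_ip_le _ _))// mulrAC ler_wpM2r ?hnorm_ge0//.
have f_lin : linear f.
  by move=> a x y; apply: ip_eq => z; rewrite -fP ipDr ipZr !fP -ipZr -ipDr.
have f_bd : exists M : R, forall x, hnorm (f x) <= M * hnorm x.
  exists M => x.
  have : hnorm (f x) ^+ 2 <= M * hnorm x * hnorm (f x).
    rewrite -ripxx /rip -fP; apply: le_trans (rip_le _ _) _.
    by rewrite mulrAC ler_wpM2r ?hnorm_ge0.
  have := hnorm_ge0 (f x); rewrite le_eqVlt => /predU1P[<- _|f0].
    by rewrite mulr_ge0 ?hnorm_ge0.
  by rewrite expr2 ler_pM2r.
by exists (mk_bop f_lin f_bd) => x y; rewrite mk_bopE.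
Qed.

Definition adj A : bounded_op H := projT1 (cid (adj_subproof A)).

Lemma adjP A x y : inner (A x) y = inner x (adj A y).
Proof. by rewrite /adj; case: cid. Qed.

Lemma adjPr A x y : inner x (A y) = inner (adj A x) y.
Proof. by rewrite ipC adjP -ipC. Qed.

Lemma adj_uniq A B : (forall x y, inner (A x) y = inner x (B y)) -> adj A = B.
Proof. by move=> AB; apply: bop_ext => y; apply: ip_eq => x; rewrite -adjP AB. Qed.

Lemma adjK : involutive adj.
Proof. by move=> A; apply: adj_uniq => x y; rewrite adjPr. Qed.

Lemma adj1 : adj 1 = 1.
Proof. exact: adj_uniq. Qed.

Lemma adj0 : adj 0 = 0.
Proof. by apply: adj_uniq => x y; rewrite !bop0E ip0l ip0r. Qed.

Lemma adjD A B : adj (A + B) = adj A + adj B.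
Proof. by apply: adj_uniq => x y; rewrite !bopDE ipDl ipDr !adjP. Qed.

Lemma adjN A : adj (- A) = - adj A.
Proof. by apply: (addrI (adj A)); rewrite -adjD !subrr adj0. Qed.

Lemma adjB A B : adj (A - B) = adj A - adj B.
Proof. by rewrite adjD adjN. Qed.

Lemma adjM A B : adj (A * B) = adj B * adj A.
Proof. by apply: adj_uniq => x y; rewrite (adjP A) (adjP B). Qed.

Lemma adjZ a A : adj (a *: A) = a^* *: adj A.
Proof. by apply: adj_uniq => x y; rewrite !bopZE ipZl ipZr adjP conjCK. Qed.

Lemma adjX A n : adj (A ^+ n) = adj A ^+ n.
Proof.
by elim: n => [|n IH]; rewrite ?expr0 ?adj1// exprS adjM IH -exprSr.
Qed.

Lemma adj_sum I (r : seq I) (F : I -> bounded_op H) :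
  adj (\sum_(i <- r) F i) = \sum_(i <- r) adj (F i).
Proof. exact: (big_morph adj adjD adj0). Qed.

Lemma opbd_adj A M : 0 <= M -> opbd A M -> opbd (adj A) M.
Proof.
move=> M0 AM x.
have : hnorm (adj A x) ^+ 2 <= M * hnorm x * hnorm (adj A x).
  rewrite -ripxx /rip -adjP; apply: le_trans (rip_le _ _) _.
  by rewrite mulrAC ler_wpM2r ?hnorm_ge0.
have := hnorm_ge0 (adj A x); rewrite le_eqVlt => /predU1P[<- _|f0].
  by rewrite mulr_ge0 ?hnorm_ge0.
by rewrite expr2 ler_pM2r.
Qed.

Lemma comm_adj A B : GRing.comm A B -> GRing.comm (adj A) (adj B).
Proof. by rewrite /GRing.comm -!adjM => ->. Qed.

Lemma normal_hnorm A x : GRing.comm A (adj A) -> hnorm (adj A x) = hnorm (A x).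
Proof.
move=> nA; apply/eqP; rewrite -(@eqrXn2 _ 2)// ?hnorm_ge0// -!ripxx /rip.
by rewrite -adjP adjPr -!bopME nA.
Qed.

End Adjoint.

(** * Fuglede's theorem *)

Section Fuglede.
Context {R : realType} {H : hilbertType R}.
Implicit Types (x y z : H) (A B S : bounded_op H).

(** Over the algebraically closed field [R[i]] of characteristic zero, X^n - 1 has [n] distinct
    roots, and [n] distinct n-th roots of unity include a primitive one. *)
Lemma complex_prim_root n : (0 < n)%N -> exists w : R[i], n.-primitive_root w.
Proof.
pose p : {poly R[i]} := 'X^n - 1; have [r Dp] := closed_field_poly_normal p.
move=> n_gt0; rewrite (monicP _) ?monicXnsubC // scale1r in Dp.
have rn1 : all n.-unity_root r by apply/allP => z; rewrite -root_prod_XsubC -Dp.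
have sz_r : (n < (size r).+1)%N.
  by rewrite -(size_prod_XsubC r id) -Dp size_XnsubC.
have [|z] := hasP (has_prim_root n_gt0 rn1 _ sz_r); last by exists z.
by rewrite -separable_prod_XsubC -Dp separable_Xn_sub_1 // pnatr_eq0 -lt0n.
Qed.

Lemma sum_unity_roots n (u : R[i]) : u ^+ n = 1 -> u != 1 -> \sum_(i < n) u ^+ i = 0.
Proof.
move=> un u1; apply/eqP; have := subrX1 u n.
by rewrite un subrr => /esym/eqP; rewrite mulf_eq0 subr_eq0 (negPf u1).
Qed.

Lemma normc_unity_root n (w : R[i]) : (0 < n)%N -> w ^+ n = 1 -> normc w = 1.
Proof.
move=> n0 wn; apply: (@pexpIrn _ n) => //; rewrite ?nnegrE ?normc_ge0//.
apply: complexI; rewrite !rmorphXn/= expr1n.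
by rewrite -[LHS]/(`|w| ^+ n) -normrX wn normr1.
Qed.

(* Average over the roots of unity of order n + 1. *)
Lemma opbd_coef1 n (c : nat -> bounded_op H) (r M : R) : (0 < n)%N ->
  (forall e : R[i], normc e = r ->
    opbd (\sum_(j < n.+1) e ^+ j *: c j) M) ->
  0 <= r -> opbd (r%:C%C *: c 1%N) M.
Proof.
move=> n_gt0 cM r0; have [w wP] := complex_prim_root (ltn0Sn n).
have wn1 : normc w = 1 by apply: (@normc_unity_root n.+1) => //; exact: prim_expr_order.
have w0 : w != 0 by apply: contra_eq_neq wn1 => ->; rewrite normc0 eq_sym oner_neq0.
have normcX (a : R[i]) k : normc (a ^+ k) = normc a ^+ k.
  by elim: k => [|k IH]; rewrite ?expr0 ?normc1// !exprS normcM IH.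
(* [P l] is the polynomial at [r w^l]. Weighted by [w^-l] and summed over [l], all degrees cancel
   except degree 1, which survives [n.+1] times. *)
pose P l := \sum_(j < n.+1) (r%:C%C * w ^+ l) ^+ j *: c j.
have PM l : opbd (w ^- l *: P l) M.
  have -> : M = normc (w ^- l) * M.
    by rewrite normcV normcX wn1 expr1n invr1 mul1r.
  apply/opbdZ/cM.
  by rewrite normcM normcX wn1 expr1n mulr1 /= expr0n/= addr0 sqrtr_sqr ger0_norm.
have sumP : \sum_(l < n.+1) w ^- l *: P l = n.+1%:R *: (r%:C%C *: c 1%N).
  under eq_bigr do rewrite /P scaler_sumr.
  rewrite exchange_big/= (bigD1 (Ordinal (n_gt0 : (1 < n.+1)%N)))//=.
  rewrite [X in _ + X]big1 ?addr0.
    under eq_bigr do rewrite scalerA mulrCA mulVf ?expf_neq0// mulr1.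
    by rewrite sumr_const card_ord scaler_nat.
  move=> j j1.
  under eq_bigr => l _.
    rewrite scalerA exprMn mulrCA -exprM mulnC exprM -exprVn -exprMn -scalerA.
    over.
  rewrite -scaler_sumr -scaler_suml sum_unity_roots ?scale0r ?scaler0//.
    by rewrite exprMn -exprM mulnC exprM exprVn (prim_expr_order wP) expr1n invr1 mul1r.
  (* [w^j = w] would force [j = 1], both exponents being below the order of [w]. *)
  apply: contra_neq j1 => /(canRL (mulKf (invr_neq0 w0))); rewrite invrK mulr1.
  rewrite -[in RHS](expr1 w) => /eqP; rewrite (eq_prim_root_expr wP).
  rewrite !modn_small ?ltnS ?(ltnW n_gt0)//; last by rewrite -ltnS.
  by move=> /eqP jE; apply: val_inj.
have := @opbd_sum _ _ _ (index_enum 'I_n.+1) _ _ (fun l => PM (val l)).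
rewrite sumP sumr_const card_ord => h x.
have n1 : 0 < n.+1%:R :> R by [].
rewrite -(ler_pM2l n1) mulrA [n.+1%:R * M]mulr_natl.
apply: le_trans (h x).
rewrite [X in _ <= hnorm X]bopZE [X in _ <= X]hnormZ ler_wpM2r ?hnorm_ge0//.
rewrite -lecR le_eqVlt; apply/orP; left; apply/eqP.
by rewrite rmorph_nat -[RHS]/(`|n.+1%:R : R[i]|) normr_nat.
Qed.

Variables (A : bounded_op H).
Hypothesis A_normal : GRing.comm A (adj A).
Let B := adj A.
Let D S := B * S - S * B.
(** The part of exp(eB) S exp(-eB) of degree at most one in [e]; iterates of [L] replace the
    exponentials by polynomials in [e]. *)
Let L (e : R[i]) S := S + e *: D S.

Let commD S : GRing.comm A S -> GRing.comm A (D S).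
Proof. by move=> AS; apply: commrB; apply: commrM. Qed.

Let commL e S : GRing.comm A S -> GRing.comm A (L e S).
Proof. by move=> AS; apply: commrD => //; apply/comm_bopZ/commD. Qed.

Let opbdL e S (b s : R) : 0 <= b -> opbd B b -> 0 <= s -> opbd S s ->
  GRing.comm A S -> opbd (L e S) (s * (1 + 2 * (normc e * b) ^+ 2)).
Proof.
move=> b0 Bb s0 Ss AS.
pose q := 1 + e *: B; pose q' := 1 - e *: B.
(* [L e S] differs from [q S q'] only by [e^2 B S B], and [q q' = 1 - e^2 B^2]: no term of first
   order in [e] is left to estimate. *)
have LE : L e S = q * S * q' + (e ^+ 2) *: (B * S * B).
  rewrite /L /D /q /q' mulrDl mul1r mulrBr mulr1 mulrDl scalerBr.
  rewrite -bopZAr -!bopZAl -bopZAr scalerA -expr2 opprD.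
  by rewrite !addrA subrK.
(* [q] is the adjoint of the normal [r], which commutes with [S]: |q S y| = |r S y| = |S r y|, at
   most s |r y| = s |q y|. *)
have qS y : hnorm (q (S y)) <= s * hnorm (q y).
  pose r := 1 + e^* *: A.
  have qE : q = adj r by rewrite adjD adj1 adjZ conjCK.
  have rn : GRing.comm r (adj r).
    rewrite -qE; apply: commrD; first exact: commr1.
    apply/comm_bopZ/commr_sym/commrD; first exact: commr1.
    exact/comm_bopZ/commr_sym.
  have Sr : GRing.comm S r.
    by apply: commrD; [exact: commr1 | apply/comm_bopZ/commr_sym].
  by rewrite qE !normal_hnorm// -bopME -Sr bopME.
have qq : opbd (q * q') (1 + (normc e * b) ^+ 2).
  have -> : q * q' = 1 + (- e ^+ 2) *: (B * B).
    rewrite /q /q' mulrDl mul1r mulrBr mulr1 -bopZAl -bopZAr scalerA -expr2.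
    by rewrite addrA subrK scaleNr.
  apply: opbdD; first exact: opbd1.
  have -> : (normc e * b) ^+ 2 = normc (- e ^+ 2) * (b * b).
    by rewrite -mulN1r !normcM normcN normc1; ring.
  exact/opbdZ/opbdM.
rewrite LE; have -> : s * (1 + 2 * (normc e * b) ^+ 2) =
   s * (1 + (normc e * b) ^+ 2) + normc (e ^+ 2) * (b * s * b).
  by rewrite expr2 normcM; ring.
apply: opbdD.
  move=> x; rewrite -mulrA !bopME (le_trans (qS _))// -mulrA ler_wpM2l//.
  exact: qq.
by apply/opbdZ/opbdM => //; [exact: mulr_ge0 | exact: opbdM].
Qed.

(** [c 1] is the coefficient that [opbd_coef1] isolates. The vanishing of [c j] beyond [n] carries
    the induction, in which [c j] becomes [c j + D (c (j - 1))]. *)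
Let iterL n S : exists c : nat -> bounded_op H,
  [/\ c 0%N = S, c 1%N = n%:R *: D S, forall j, (n < j)%N -> c j = 0
    & forall e, iter n (L e) S = \sum_(j < n.+1) e ^+ j *: c j].
Proof.
have D0 : D 0 = 0 by rewrite /D mulr0 mul0r subrr.
have DD U V : D (U + V) = D U + D V.
  by rewrite /D mulrDr mulrDl opprD addrACA.
have DZ a U : D (a *: U) = a *: D U.
  by rewrite /D scalerBr -bopZAr -bopZAl.
elim: n => [|n [c [c0 c1 cn cE]]].
  exists (fun j => if j is 0%N then S else 0); split => //.
  - by rewrite scale0r.
  - by case.
  - by move=> e; rewrite big_ord1/= expr0 scale1r.
exists (fun j => c j + if j is k.+1 then D (c k) else 0); split.
- by rewrite c0 addr0.
- by rewrite c0 c1 -[X in _ + X]scale1r -scalerDl natr1.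
- case=> // j nj; rewrite !cn ?D0 ?addr0//; exact: ltnW.
move=> e; rewrite iterS cE {1}/L.
under [RHS]eq_bigr do rewrite scalerDr.
rewrite big_split/= [in RHS]big_ord_recr/= (cn n.+1)// scaler0 addr0; congr (_ + _).
rewrite [RHS]big_ord_recl/= scaler0 add0r (big_morph D DD D0) scaler_sumr.
by apply: eq_bigr => j _; rewrite DZ scalerA -exprS.
Qed.

Theorem fuglede S : GRing.comm A S -> GRing.comm (adj A) S.
Proof.
move=> AS; apply/subr0_eq; rewrite -/B -/(D S).
have [b [b1 Bb]] := bop_bound B; have [s [s1 Ss]] := bop_bound S.
have b0 : 0 <= b by exact: le_trans b1.
have s0 : 0 <= s by exact: le_trans s1.
have iterb e n : opbd (iter n (L e) S) (s * (1 + 2 * (normc e * b) ^+ 2) ^+ n)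
    /\ GRing.comm A (iter n (L e) S).
  elim: n => [|n [IH1 IH2]]; first by rewrite expr0 mulr1.
  split; last exact: commL.
  rewrite exprSr mulrA; apply: opbdL => //.
  by rewrite mulr_ge0// exprn_ge0// addr_ge0// mulr_ge0// sqr_ge0.
have key (z : R) : 0 < z -> opbd (z%:C%C *: D S) (s * expR 1).
  (* For |e| = z / n one iteration contributes the factor 1 + X / n^2; if n is at least X, its n-th
     power is at most exp(X / n), hence at most exp 1, whatever [z]. *)
  move=> z0; pose X := 2 * (z * b) ^+ 2.
  have X0 : 0 <= X by rewrite mulr_ge0// sqr_ge0.
  pose n := (Num.bound X).+1.
  have Xn : X <= n%:R.
    by rewrite (le_trans (ltW (archi_boundP X0)))// ler_nat.
  have n0 : 0 < n%:R :> R by [].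
  have [c [_ c1 _ cE]] := iterL n S.
  have -> : z%:C%C *: D S = (z / n%:R)%:C%C *: c 1%N.
    rewrite c1 scalerA; congr (_ *: _).
    by rewrite -(rmorph_nat (real_complex R) n) -rmorphM divfK ?gt_eqF.
  apply: (@opbd_coef1 n) => //; last by rewrite divr_ge0 ?ltW.
  move=> e en; rewrite -cE; apply: opbdW (iterb e n).1.
  rewrite ler_wpM2l// en.
  have -> : 2 * (z / n%:R * b) ^+ 2 = X / n%:R ^+ 2.
    by rewrite /X; field; rewrite gt_eqF.
  apply: (@le_trans _ _ (expR (X / n%:R ^+ 2) ^+ n)).
    rewrite lerXn2r ?nnegrE ?expR_ge0 ?expR_ge1Dx//.
    by rewrite addr_ge0// divr_ge0// exprn_ge0.
  rewrite -expRM_natl ler_expR.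
  have -> : n%:R * (X / n%:R ^+ 2) = X / n%:R by field; rewrite gt_eqF.
  by rewrite ler_pdivrMr// mul1r.
apply: bop_ext => x; rewrite bop0E; apply: hnorm_eq0.
apply/eqP; rewrite eq_le hnorm_ge0 andbT leNgt; apply/negP => d0.
have C0 : 0 <= s * expR 1 * hnorm x by rewrite !mulr_ge0 ?hnorm_ge0 ?expR_ge0.
(* This [z] makes [z |D S x|] exceed the bound by 1, a contradiction. *)
have z0 : 0 < (s * expR 1 * hnorm x + 1) / hnorm (D S x).
  by rewrite divr_gt0// ltr_wpDl.
have := key _ z0 x; rewrite bopZE hnormZ.
have -> (t : R) : normc t%:C%C = `|t| by rewrite /= expr0n/= addr0 sqrtr_sqr.
by rewrite gtr0_norm// divfK ?gt_eqF//; lra.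
Qed.

End Fuglede.

(** * Norm limits of operators *)

Section OperatorLimits.
Context {R : realType} {H : hilbertType R}.
Implicit Types (A B : nat -> bounded_op H) (K L : bounded_op H).

(** Norm convergence witnessed by an explicit rate, instead of through a topology on
    [bounded_op H]. *)
Definition opcvg A L := exists e : nat -> R,
  [/\ forall n, 0 <= e n, e @ \oo --> 0 & forall n, opbd (L - A n) (e n)].

Lemma opcvg_unique A K L : opcvg A K -> opcvg A L -> K = L.
Proof.
move=> [d [d0 dl dK]] [e [e0 el eL]].
apply: (@bop_ext_lim _ _ _ _ (fun n => d n + e n)).
  by rewrite -[X in _ --> X](addr0 0); exact: cvgD.
move=> n; have -> : K - L = (K - A n) + - (L - A n).
  by rewrite opprB addrA subrK.
exact/opbdD/opbdN.
Qed.

Lemma opcvg_cst L : opcvg (fun=> L) L.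
Proof.
exists (fun=> 0); split => //; first exact: cvg_cst.
by move=> n; rewrite subrr; exact: opbd0.
Qed.

Lemma opcvgM A B K L : opcvg A K -> opcvg B L -> opcvg (fun n => A n * B n) (K * L).
Proof.
move=> [d [d0 dl dK]] [e [e0 el eL]].
have [M [M1 KM]] := bop_bound K; have [N [N1 LN]] := bop_bound L.
have M0 : 0 <= M by exact: le_trans M1.
have N0 : 0 <= N by exact: le_trans N1.
exists (fun n => (M + d n) * e n + d n * N); split => [n||n].
- by rewrite addr_ge0// mulr_ge0// addr_ge0.
- rewrite -[X in _ --> X](_ : (M + 0) * 0 + 0 * N = 0); last by rewrite mulr0 mul0r addr0.
  apply: cvgD; apply: cvgM => //; [apply: cvgD => //|]; exact: cvg_cst.
have -> : K * L - A n * B n = A n * (L - B n) + (K - A n) * L.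
  by rewrite mulrBr mulrBl [RHS]addrC addrA subrK.
have AM : opbd (A n) (M + d n).
  have -> : A n = K + - (K - A n) by rewrite opprB addrC subrK.
  exact/opbdD/opbdN.
by apply: opbdD; apply: opbdM => //; rewrite addr_ge0.
Qed.

Lemma opcvgD A B K L : opcvg A K -> opcvg B L -> opcvg (fun n => A n + B n) (K + L).
Proof.
move=> [d [d0 dl dK]] [e [e0 el eL]]; exists (fun n => d n + e n); split => [n||n].
- exact: addr_ge0.
- by rewrite -[X in _ --> X](addr0 0); exact: cvgD.
by rewrite opprD addrACA; exact: opbdD.
Qed.

Lemma opcvg_adj A L : opcvg A L -> opcvg (fun n => adj (A n)) (adj L).
Proof.
move=> [e [e0 el eL]]; exists e; split => // n.
by rewrite -adjB; exact: opbd_adj.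
Qed.

Lemma opcvg_comm A L (B : bounded_op H) :
  opcvg A L -> (forall n, GRing.comm B (A n)) -> GRing.comm B L.
Proof.
move=> AL BA; apply: (@opcvg_unique (fun n => B * A n)).
  by apply: opcvgM => //; exact: opcvg_cst.
rewrite [fun n => _](_ : _ = fun n => A n * B); last by apply/funext => n; exact: BA.
by apply: opcvgM => //; exact: opcvg_cst.
Qed.

End OperatorLimits.

(** * Real polynomials of an operator *)

Section PolynomialEvaluation.
Context {R : realType} {H : hilbertType R}.
Implicit Types (p q : {poly R}) (c : R) (S B : bounded_op H).

(** The coefficients are real so that polynomials of a self-adjoint operator are self-adjoint. *)
Definition peval S p : bounded_op H := \sum_(i < size p) (p`_i)%:C%C *: S ^+ i.

Lemma peval_wide S p n : (size p <= n)%N ->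
  peval S p = \sum_(i < n) (p`_i)%:C%C *: S ^+ i.
Proof.
move=> pn; rewrite /peval (big_ord_widen n (fun i => (p`_i)%:C%C *: S ^+ i))//.
rewrite big_mkcond/=; apply: eq_bigr => i _; case: ltnP => // pi.
by rewrite nth_default// scale0r.
Qed.

Lemma pevalD S p q : peval S (p + q) = peval S p + peval S q.
Proof.
set n := maxn (size p) (size q).
rewrite (@peval_wide _ _ n) ?size_polyD// (@peval_wide _ p n) ?leq_maxl//.
rewrite (@peval_wide _ q n) ?leq_maxr// -big_split/=.
by apply: eq_bigr => i _; rewrite coefD rmorphD scalerDl.
Qed.

Lemma pevalZ S c p : peval S (c *: p) = c%:C%C *: peval S p.
Proof.
rewrite (@peval_wide _ _ (size p)) ?size_scale_leq// scaler_sumr.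
by apply: eq_bigr => i _; rewrite coefZ rmorphM scalerA.
Qed.

Lemma pevalB S p q : peval S (p - q) = peval S p - peval S q.
Proof. by rewrite -scaleN1r pevalD pevalZ rmorphN1 scaleN1r. Qed.

Lemma pevalC S c : peval S c%:P = c%:C%C *: (1 : bounded_op H).
Proof.
by rewrite (@peval_wide _ _ 1) ?size_polyC_leq1// big_ord1 coefC expr0.
Qed.

Lemma pevalMX S p : peval S (p * 'X) = peval S p * S.
Proof.
rewrite (@peval_wide _ _ (size p).+1); last first.
  by have [->|p0] := eqVneq p 0; rewrite ?mul0r ?size_poly0// size_mulX.
rewrite big_ord_recl coefMX/= scale0r add0r mulr_suml.
by apply: eq_bigr => i _; rewrite coefMX/= exprSr bopZAl.
Qed.

Lemma comm_peval S p B : GRing.comm B S -> GRing.comm B (peval S p).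
Proof. by move=> BS; apply: commr_sum => i _; apply/comm_bopZ/commrX. Qed.

Lemma pevalM S p q : peval S (p * q) = peval S p * peval S q.
Proof.
elim/poly_ind: p => [|p c IH].
  by rewrite mul0r /peval size_poly0 big_ord0 mul0r.
rewrite mulrDl -mulrA ['X * q]mulrC mulrA pevalD pevalMX IH mul_polyC pevalZ.
rewrite pevalD pevalMX pevalC mulrDl -bopZAl mul1r -!mulrA.
by congr (_ * _ + _); apply/commr_sym/comm_peval.
Qed.

Lemma adj_peval S p : adj S = S -> adj (peval S p) = peval S p.
Proof.
move=> SS; rewrite adj_sum; apply: eq_bigr => i _.
by rewrite adjZ adjX SS; congr (_ *: _); exact: conjc_real.
Qed.

Lemma opbd_peval S p (q : R) : 0 <= q -> opbd S q ->
  opbd (peval S p) (\sum_(i < size p) `|p`_i| * q ^+ i).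
Proof.
move=> q0 Sq; apply: opbd_sum => i.
have -> : `|p`_i| = normc (p`_i)%:C%C by rewrite /= expr0n/= addr0 sqrtr_sqr.
exact/opbdZ/opbdX.
Qed.

End PolynomialEvaluation.

(** * Coefficients of the binomial series *)

Section BinomialSeries.
Context {R : realType}.
Implicit Types (s t : R).

(* Coefficients of the power series of (1 - x) ^ s. *)
Fixpoint bcoef s n : R :=
  if n is m.+1 then bcoef s m * (m%:R - s) / m.+1%:R else 1.

Lemma bcoefS s n : n.+1%:R * bcoef s n.+1 = (n%:R - s) * bcoef s n.
Proof. by rewrite /= mulrC divfK// mulrC. Qed.

(** The series of exponent 0 and, in [bcoef1], of exponent 1 terminate: they are [1] and [1 - x]. *)
Lemma bcoef0 n : bcoef 0 n.+1 = 0.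
Proof.
elim: n => [|n IH]; first by rewrite /= subr0 mulr0 mul0r.
by rewrite -[LHS]/(bcoef 0 n.+1 * _ / _) IH !mul0r.
Qed.

Lemma bcoef1 n : bcoef 1 n.+2 = 0.
Proof.
elim: n => [|n IH]; first by rewrite /= subrr mulr0 mul0r.
by rewrite -[LHS]/(bcoef 1 n.+2 * _ / _) IH !mul0r.
Qed.

(** Each factor |m - s| / (m + 1) is at most 1; this crude bound suffices, the series being used at
    operators of norm below 1. *)
Lemma bcoef_le1 s n : `|s| <= 1 -> `|bcoef s n| <= 1.
Proof.
move=> s1; elim: n => [|n IH] /=; first by rewrite normr1.
rewrite !normrM normfV (ger0_norm (ler0n _ _)) ler_pdivrMr// mul1r.
rewrite -[leRHS]mul1r ler_pM// (le_trans (ler_normB _ _))//.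
by rewrite ger0_norm// -natr1 lerD2l.
Qed.

(* Both sides satisfy (n + 1) c_(n+1) = (n - s - t) c_n. *)
Lemma bcoef_vandermonde s t n :
  \sum_(i < n.+1) bcoef s i * bcoef t (n - i) = bcoef (s + t) n.
Proof.
elim: n => [|n IH]; first by rewrite big_ord1 subn0 /= mulr1.
have n1 : n.+1%:R != 0 :> R by rewrite pnatr_eq0.
apply: (mulfI n1); rewrite bcoefS -IH mulr_sumr.
(* Writing [n.+1] as [i + (n.+1 - i)] lets [bcoefS] lower one index in each half; the two
   multipliers then add up to [n - s - t]. *)
have -> : \sum_(i < n.+2) n.+1%:R * (bcoef s i * bcoef t (n.+1 - i)) =
    \sum_(i < n.+2) (i%:R * bcoef s i) * bcoef t (n.+1 - i) +
    \sum_(i < n.+2) bcoef s i * ((n.+1 - i)%:R * bcoef t (n.+1 - i)).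
  rewrite -big_split/=; apply: eq_bigr => i _.
  have -> : n.+1%:R = i%:R + (n.+1 - i)%:R :> R.
    by rewrite -natrD subnKC// -ltnS.
  by ring.
rewrite big_ord_recl/= !mul0r add0r [X in _ + X]big_ord_recr/= subnn mul0r mulr0 addr0.
rewrite -big_split/= mulr_sumr; apply: eq_bigr => i _.
have i_n : (i <= n)%N by rewrite -ltnS.
rewrite /bump/= add1n subSS subSn// -/(bcoef s i.+1) -/(bcoef t (n - i).+1).
rewrite !bcoefS natrB//.
by ring.
Qed.

End BinomialSeries.

(** * Powers of [1 - S] for an operator [S] of norm below 1 *)

Section OperatorBinomial.
Context {R : realType} {H : hilbertType R}.
Variables (S : bounded_op H) (q : R).
Hypotheses (q_ge0 : 0 <= q) (q_lt1 : q < 1) (S_q : opbd S q).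

(** A ratio strictly between [q] and 1: passing from [q^i] to [r^i] absorbs coefficients growing
    like [i + 1]. *)
Let r := (1 + q) / 2.
Let c := r - q.

Let r_lt1 : r < 1. Proof. by rewrite /r; move: q_lt1; lra. Qed.
Let q_lt_r : q < r. Proof. by rewrite /r; move: q_lt1; lra. Qed.
Let r_ge0 : 0 <= r. Proof. exact/ltW/(le_lt_trans q_ge0). Qed.
Let c_gt0 : 0 < c. Proof. by rewrite subr_gt0. Qed.

(** Behind the induction: r^(i+1) - q^(i+1) is r - q times a sum of [i + 1] products r^j q^(i-j),
    each at least q^i. *)
Let linear_geometric i : i.+1%:R * q ^+ i <= r ^+ i / c.
Proof.
rewrite ler_pdivlMr//; apply: (@le_trans _ _ (r ^+ i.+1 - q ^+ i.+1)).
  elim: i => [|i IH]; first by rewrite expr0 !expr1 !mul1r.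
  have qr : q ^+ i.+1 <= r ^+ i.+1 by rewrite lerXn2r// ?nnegrE// ltW.
  have h1 := ler_wpM2l q_ge0 IH.
  have h2 := ler_wpM2l (ltW c_gt0) qr.
  have -> : i.+2%:R * q ^+ i.+1 * c = q * (i.+1%:R * q ^+ i * c) + c * q ^+ i.+1.
    by rewrite -[i.+2%:R]natr1 (exprS q i); ring.
  by rewrite (exprS r i.+1) (exprS q i.+1); move: h1 h2; rewrite /c; lra.
rewrite exprS; have := exprn_ge0 i r_ge0; have := exprn_ge0 i.+1 q_ge0.
by move: r_lt1; nra.
Qed.

Let geometric_tail n N :
  (\sum_(i < N) if (n <= i)%N then r ^+ i else 0) * (1 - r) <= r ^+ n.
Proof.
(* The exact value, with [maxn n N], is what an induction on [N] can carry. *)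
suff h : (\sum_(i < N) if (n <= i)%N then r ^+ i else 0) * (1 - r) +
    r ^+ maxn n N = r ^+ n.
  by rewrite -h lerDl exprn_ge0.
elim: N => [|N IH]; first by rewrite big_ord0 mul0r add0r maxn0.
rewrite -IH big_ord_recr/= mulrDl; case: leqP => nN.
  by rewrite (maxn_idPr (leqW nN)) exprS; ring.
by rewrite (maxn_idPl nN); ring.
Qed.

Let K := (c * (1 - r))^-1.

Let K_ge0 : 0 <= K.
Proof. by rewrite invr_ge0 mulr_ge0 ?subr_ge0 ?ltW. Qed.

(** The bound depends on the order of vanishing and not on the degree. Coefficients up to [i + 1]
    are allowed because products of two truncated series have them. *)
Let opbd_tail (p : {poly R}) n : (forall i, (i < n)%N -> p`_i = 0) ->
  (forall i, `|p`_i| <= i.+1%:R) -> opbd (peval S p) (K * r ^+ n).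
Proof.
move=> p0 p1; apply: opbdW (opbd_peval p q_ge0 S_q).
have r1 : 0 < 1 - r by rewrite subr_gt0.
rewrite /K mulrC ler_pdivlMr ?mulr_gt0//; apply: le_trans (geometric_tail n (size p)).
rewrite mulrA ler_wpM2r ?(ltW r1)// mulr_suml; apply: ler_sum => i _.
case: leqP => ni; last by rewrite p0// normr0 !mul0r.
rewrite -ler_pdivlMr//; apply: le_trans (linear_geometric i).
by rewrite ler_wpM2r// exprn_ge0.
Qed.

Let cvg_tail : (fun n => K * r ^+ n) @ \oo --> (0 : R).
Proof. by apply: cvg_geometric; rewrite ger0_norm. Qed.

Let opcvg_tail (p : nat -> {poly R}) :
  (forall n i, (i < n)%N -> (p n)`_i = 0) ->
  (forall n i, `|(p n)`_i| <= i.+1%:R) -> opcvg (fun n => peval S (p n)) 0.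
Proof.
move=> p0 p1; exists (fun n => K * r ^+ n); split => // n.
  by rewrite mulr_ge0// exprn_ge0.
by rewrite sub0r; apply: opbdN; apply: opbd_tail => i; [exact: p0|exact: p1].
Qed.

(** With [n.+2] terms every truncation at [s = 1], even for [n = 0], is all of 1 - X. *)
Let bpol s n : {poly R} := \poly_(i < n.+2) bcoef s i.

Let bpol_le1 s n i : `|s| <= 1 -> `|(bpol s n)`_i| <= 1.
Proof.
by move=> s1; rewrite coef_poly; case: ifP; rewrite ?normr0 ?bcoef_le1.
Qed.

Let bpol_cvg s : `|s| <= 1 -> exists F, opcvg (fun n => peval S (bpol s n)) F.
Proof.
move=> s1; have [F FP] : exists F, forall n, opbd (F - peval S (bpol s n)) (K * r ^+ n).
  apply: bop_complete => // m n mn; rewrite -pevalB; apply: opbd_tail => i.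
    move=> im; have i_n := leq_trans im mn.
    by rewrite coefB !coef_poly (leqW (leqW im)) (leqW (leqW i_n)) subrr.
  have bi : `|bcoef s i| <= i.+1%:R by rewrite (le_trans (bcoef_le1 _ s1))// ler1n.
  by rewrite coefB !coef_poly; do 2!case: ifP => _;
    rewrite ?subrr ?subr0 ?sub0r ?normrN ?normr0.
by exists F, (fun n => K * r ^+ n); split => // n; rewrite mulr_ge0 ?exprn_ge0.
Qed.

(** By the Vandermonde identity the product of the truncations agrees with the truncation at [s + t]
    below degree [n + 2]; the rest has coefficients at most [i + 1] and tends to 0. *)
Let bpol_mul s t F G E : `|s| <= 1 -> `|t| <= 1 -> `|s + t| <= 1 ->
  opcvg (fun n => peval S (bpol s n)) F -> opcvg (fun n => peval S (bpol t n)) G ->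
  opcvg (fun n => peval S (bpol (s + t) n)) E -> F * G = E.
Proof.
move=> s1 t1 st1 sF tG stE; apply: (opcvg_unique (opcvgM sF tG)).
pose d n := bpol s n * bpol t n - bpol (s + t) n.
have dE n i : (d n)`_i = if (i < n.+2)%N then 0 else (bpol s n * bpol t n)`_i.
  rewrite coefB [(bpol (s + t) n)`_i]coef_poly; case: ifP => i_n; last by rewrite subr0.
  apply/eqP; rewrite subr_eq0 coefM -bcoef_vandermonde; apply/eqP/eq_bigr => j _.
  by rewrite !coef_poly (leq_trans _ i_n)// ?(leq_ltn_trans (leq_subr _ _) i_n)// ltn_ord.
have /(opcvgD stE) : opcvg (fun n => peval S (d n)) 0.
  apply: opcvg_tail => n i; rewrite dE.
    by move=> i_n; rewrite (ltn_trans i_n).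
  case: ifP => _; first by rewrite normr0.
  rewrite coefM (le_trans (ler_norm_sum _ _ _))//.
  rewrite -[leRHS](_ : \sum_(j < i.+1) 1 = _); last by rewrite sumr_const card_ord.
  by apply: ler_sum => j _; rewrite normrM -[leRHS]mulr1 ler_pM// bpol_le1.
rewrite addr0; congr opcvg; apply/funext => n.
by rewrite -pevalD /d addrC subrK pevalM.
Qed.

(* F s is (1 - S) ^ s. *)
Lemma operator_powers : exists F : R -> bounded_op H,
  [/\ F 0 = 1, F 1 = 1 - S,
      forall s t, `|s| <= 1 -> `|t| <= 1 -> `|s + t| <= 1 -> F s * F t = F (s + t),
      forall s, `|s| <= 1 -> adj S = S -> adj (F s) = F s
    & forall s B, `|s| <= 1 -> GRing.comm B S -> GRing.comm B (F s)].
Proof.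
have /choice[F FP] s : exists F, `|s| <= 1 -> opcvg (fun n => peval S (bpol s n)) F.
  have [/bpol_cvg[F]|s1] := boolP (`|s| <= 1); first by exists F.
  (* Default value for |s| > 1, where nothing is claimed of [F s]. *)
  by exists 0.
exists F; split.
- apply: opcvg_unique (FP 0 _) _; first by rewrite normr0.
  rewrite [fun n => _](_ : _ = fun=> 1); first exact: opcvg_cst.
  apply/funext => n; rewrite -[RHS]scale1r -(pevalC S 1); congr peval.
  apply/polyP => i; rewrite coef_poly coefC; case: i => [|i] //.
  by rewrite bcoef0 if_same.
- apply: opcvg_unique (FP 1 _) _; first by rewrite normr1.
  rewrite [fun n => _](_ : _ = fun=> 1 - S); first exact: opcvg_cst.
  apply/funext => n.
  have -> : 1 - S = peval S (1 - 'X).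
    rewrite pevalB -['X]mul1r pevalMX -(polyC1 R) pevalC.
    by rewrite scale1r mul1r.
  congr peval.
  apply/polyP => i; rewrite coef_poly coefB coef1 coefX; case: i => [|[|i]].
  + by rewrite subr0.
  + by rewrite /= !sub0r mul1r divr1.
  + by rewrite bcoef1 if_same subrr.
- by move=> s t s1 t1 st1; apply: (bpol_mul s1 t1 st1); exact: FP.
- move=> s s1 SS; apply: opcvg_unique (opcvg_adj (FP s s1)) _.
  rewrite [fun n => _](_ : _ = fun n => peval S (bpol s n)); first exact: FP.
  by apply/funext => n; exact: adj_peval.
- by move=> s B s1 BS; apply: opcvg_comm (FP s s1) _ => n; exact: comm_peval.
Qed.

End OperatorBinomial.

(** * Roots of coercive self-adjoint operators *)

Section PositiveRoot.
Context {R : realType} {H : hilbertType R}.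
Implicit Types (A B F G : bounded_op H).

(** By coercivity a small multiple [t A] has the form [1 - S] with [S] of norm below 1; the root is
    the binomial power of exponent 1/r, rescaled. *)
Lemma positive_root A (c : R) (r : nat) : 0 < c -> (0 < r)%N ->
  (forall x, c * hnorm x ^+ 2 <= rip (A x) x) -> adj A = A ->
  exists F G, [/\ adj F = F, F ^+ r = A, F * G = 1, G * F = 1
    & forall B, GRing.comm B A -> GRing.comm B F].
Proof.
move=> c0 r0 Ac AA.
wlog c1 : c c0 Ac / c <= 1.
  move=> wlg; apply: (wlg (Num.min c 1)); rewrite ?ge_min ?lexx ?orbT//.
    by rewrite lt_min c0 ltr01.
  move=> x; apply: le_trans (Ac x); rewrite ler_wpM2r ?sqr_ge0//.
  by rewrite ge_min lexx.
have [M [M1 AM]] := bop_bound A.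
have M0 : 0 < M by exact: lt_le_trans M1.
(* As [t] is [s ^+ r], dividing the root of [t A] by [s] gives the root of [A]; and [t <= s] gives
   [t M^2 <= c], the smallness that [Sq] requires. *)
pose s := c / M ^+ 2.
have s0 : 0 < s by rewrite divr_gt0// exprn_gt0.
have s1 : s <= 1.
  by rewrite ler_pdivrMr ?exprn_gt0// mul1r (le_trans c1)// exprn_ege1.
have sM : s * M ^+ 2 = c by rewrite divfK// gt_eqF// exprn_gt0.
pose t := s ^+ r.
have t0 : 0 < t by rewrite exprn_gt0.
have ts : t <= s.
  by rewrite /t -(prednK r0) exprS -[leRHS]mulr1 ler_wpM2l ?exprn_ile1 ?(ltW s0).
have t1 : t <= 1 by exact: le_trans s1.
have tM : t * M ^+ 2 <= c by rewrite -sM ler_wpM2r// sqr_ge0.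
(* |S x|^2 will be at most (1 - tc) |x|^2, and 1 - tc is at most (1 - tc/2)^2. *)
pose q := 1 - t * c / 2.
have tc : t * c <= 1 by rewrite -[leRHS]mulr1 ler_pM ?(ltW t0) ?(ltW c0).
have tc0 : 0 < t * c by rewrite mulr_gt0.
have q0 : 0 <= q by rewrite /q; lra.
have q1 : q < 1 by rewrite /q; lra.
pose S := 1 - t%:C%C *: A.
have SS : adj S = S by rewrite adjB adj1 adjZ AA; congr (_ - _ *: _); exact: conjc_real.
have Sq : opbd S q.
  move=> x; rewrite -ler_sqr ?nnegrE ?hnorm_ge0 ?mulr_ge0 ?hnorm_ge0//.
  rewrite exprMn bopBE bopZE hnorm_sqB ripZr ripC -!ripxx ripZl ripZr !ripxx.
  have h1 := ler_wpM2l (ltW t0) (Ac x).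
  have h2 : t * (t * hnorm (A x) ^+ 2) <= t * c * hnorm x ^+ 2.
    rewrite -mulrA ler_wpM2l ?(ltW t0)//.
    apply: (@le_trans _ _ (t * (M ^+ 2 * hnorm x ^+ 2))).
      rewrite ler_wpM2l ?(ltW t0)// -exprMn ler_sqr ?nnegrE ?hnorm_ge0//.
      by rewrite mulr_ge0 ?hnorm_ge0 ?(ltW M0).
    by rewrite mulrA ler_wpM2r// sqr_ge0.
  have h3 : (1 - t * c) * hnorm x ^+ 2 <= q ^+ 2 * hnorm x ^+ 2.
    rewrite ler_wpM2r ?sqr_ge0//.
    have -> : q ^+ 2 = 1 - t * c + (t * c / 2) ^+ 2 by rewrite /q; field.
    by rewrite lerDl sqr_ge0.
  by apply: le_trans h3; lra.
have [F [F0 F1 FD FS FB]] := operator_powers q0 q1 Sq.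
have rr0 : r%:R != 0 :> R by rewrite pnatr_eq0 -lt0n.
have ir0 : 0 < r%:R^-1 :> R by rewrite invr_gt0 ltr0n.
have ir1 : `|r%:R^-1| <= 1 :> R by rewrite gtr0_norm// invf_le1 ?ltr0n// ler1n.
have FX j : (j <= r)%N -> F r%:R^-1 ^+ j = F (j%:R / r%:R).
  elim: j => [|j IH] jr; first by rewrite expr0 mul0r F0.
  have nle k : (k <= r)%N -> `|k%:R / r%:R| <= 1 :> R.
    move=> kr; rewrite ger0_norm ?divr_ge0// ler_pdivrMr ?ltr0n//.
    by rewrite mul1r ler_nat.
  have jE : r%:R^-1 + j%:R / r%:R = j.+1%:R / r%:R :> R.
    by rewrite -natr1 mulrDl mul1r addrC.
  rewrite exprS IH ?(ltnW jr)// FD ?jE//; apply: nle => //; exact: ltnW.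
exists ((s^-1)%:C%C *: F r%:R^-1), (s%:C%C *: F (- r%:R^-1)); split.
- rewrite adjZ FS//; congr (_ *: _); exact: conjc_real.
- rewrite bopZX FX// divff// F1 /S opprB addrC subrK scalerA -rmorphXn -rmorphM/=.
  by rewrite exprVn mulVf ?scale1r// gt_eqF.
- rewrite -bopZAl -bopZAr scalerA -rmorphM mulVf ?gt_eqF// scale1r.
  by rewrite FD ?normrN ?subrr ?normr0.
- rewrite -bopZAl -bopZAr scalerA -rmorphM mulfV ?gt_eqF// scale1r.
  by rewrite FD ?normrN ?addNr ?normr0.
- move=> B BA; apply/comm_bopZ/FB => //.
  by apply: commrB; [exact: commr1 | exact: comm_bopZ].
Qed.

End PositiveRoot.

(** * Drazin inverses in a ring *)

Section DrazinInverse.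
Context {A : pzRingType}.
Implicit Types (x y z : A) (p : nat).

Lemma comm_inverse x y z : x * y = 1 -> y * x = 1 -> GRing.comm z x -> GRing.comm z y.
Proof.
move=> xy yx zx; rewrite /GRing.comm.
by rewrite -[z * y]mul1r -yx -mulrA [x * _]mulrA -zx -[z * x * y]mulrA xy mulr1.
Qed.

Definition ring_drazin p x y :=
  [/\ GRing.comm y x, y * y * x = y & x ^+ p * x * y = x ^+ p].

(** Iterating [y y x = y] puts a power of [x] beside [y], on which the third Drazin equation can
    act. *)
Lemma drazin_expand p x y n : ring_drazin p x y -> y ^+ n.+1 * x ^+ n = y.
Proof.
case=> yx yyx _; elim: n => [|n IH]; first by rewrite expr0 mulr1.
by rewrite (exprS y) (exprSr x) mulrA -[y * _ * _]mulrA IH yyx.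
Qed.

(** Expanding [y] moves [z] past [x^p] and gives y z = y z x y and z y = x y z y; the right sides
    agree because [z] and [y] commute with [x]. *)
Lemma drazin_comm p x y z : ring_drazin p x y -> GRing.comm z x -> GRing.comm z y.
Proof.
move=> d zx; have [yx _ xpxy] := d; have yE := drazin_expand p d.
have zxp : z * x ^+ p = x ^+ p * z by exact: commrX.
have yE' : x ^+ p * y ^+ p.+1 = y.
  by rewrite -[RHS]yE; apply: commr_sym; apply/commrX/commr_sym/commrX/commr_sym.
have yz : y * z = y * z * x * y.
  transitivity (y ^+ p.+1 * z * (x ^+ p * x * y)).
    by rewrite xpxy -mulrA zxp mulrA yE.
  by rewrite -[X in _ = X * _ * _ * _]yE !mulrA -(mulrA _ z) zxp !mulrA.
have exp : x * y * x ^+ p = x ^+ p.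
  rewrite -[RHS]xpxy -[RHS]mulrA; apply: commr_sym; apply: commrM.
    exact/commr_sym/commrX.
  exact/commr_sym/commrX.
have zy : z * y = x * y * z * y.
  have zyE : z * y = x ^+ p * z * y ^+ p.+1 by rewrite -[in LHS]yE' mulrA zxp.
  by rewrite -[RHS]mulrA zyE !mulrA exp.
by rewrite /GRing.comm yz zy -[y * z * x]mulrA zx mulrA yx.
Qed.

(** Into the expansion of one inverse the third equation of the other inserts a factor; both
    inverses thus equal [y1 x y2]. *)
Lemma drazin_unique p q x y1 y2 : ring_drazin p x y1 -> ring_drazin q x y2 -> y1 = y2.
Proof.
move=> d1 d2; have [y1x _ d1p] := d1; have [y2x _ d2q] := d2.
have y12 : GRing.comm y2 y1 by apply: drazin_comm d1 _.
have E1 : y1 = y1 * x * y2.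
  by rewrite -{1}(drazin_expand q d1) -d2q !mulrA (drazin_expand q d1).
have E2 : y2 = y2 * x * y1.
  by rewrite -{1}(drazin_expand p d2) -d1p !mulrA (drazin_expand p d2).
by rewrite E1 [RHS]E2 y2x -[RHS]mulrA y12 mulrA -y1x.
Qed.

Lemma drazinX p x y k : ring_drazin p x y -> ring_drazin p (x ^+ k) (y ^+ k).
Proof.
case=> yx yyx xpxy; split.
- by apply/commrX/commr_sym/commrX/commr_sym.
- rewrite -exprMn_comm// -exprMn_comm ?yyx//.
  by apply: commr_sym; apply: commrM; exact/commr_sym.
have xxp : GRing.comm x (x ^+ p) by exact: commrX.
rewrite -exprM mulnC exprM -exprMn_comm; last exact/commr_sym.
rewrite -exprMn_comm ?xpxy//; apply: commr_sym; apply: commrM => //.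
exact: commrX.
Qed.

End DrazinInverse.

(** * Invertible operators with a normal power *)

Section PowerNormal.
Context {R : realType} {H : hilbertType R}.
Implicit Types (T V F G X Y P U W : bounded_op H).

Lemma adj_inverse F G : F * G = 1 -> G * F = 1 -> adj F = F -> adj G = G.
Proof.
move=> FG GF FF; have h : adj G * F = 1 by rewrite -[F]FF -adjM FG adj1.
by rewrite -[LHS]mulr1 -FG mulrA h mul1r.
Qed.

Lemma rip_adjM U x : rip ((adj U * U) x) x = hnorm (U x) ^+ 2.
Proof. by rewrite -ripxx /rip bopME (adjP (adj U)) adjK. Qed.

Lemma rip_sum I (r : seq I) (F : I -> H) y :
  rip (\sum_(i <- r) F i) y = \sum_(i <- r) rip (F i) y.
Proof.
have ripD : {morph rip^~ y : u v / u + v >-> u + v} by move=> u v; exact: ripDl.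
by apply: (big_morph (rip^~ y) ripD); rewrite /rip ip0l.
Qed.

(** The last clause makes [X] and [Y] commute with the Drazin projection, so that the similarity
    respects the decomposition of [H]. *)
Lemma power_normal_similar T V (k : nat) : (0 < k)%N -> T * V = 1 -> V * T = 1 ->
  GRing.comm (T ^+ k) (adj (T ^+ k)) ->
  exists X Y, [/\ X * Y = 1, Y * X = 1,
    GRing.comm (X * T * Y) (adj (X * T * Y)) &
    forall P, GRing.comm P T -> GRing.comm P (adj T) ->
      GRing.comm P X /\ GRing.comm P Y].
Proof.
move=> k0 TV VT nA; set A := T ^+ k in nA.
pose E := adj A * A.
have TA : GRing.comm T A by exact: commrX.
have TA' : GRing.comm T (adj A) by apply/commr_sym/fuglede => //; exact/commr_sym.
have EE : adj E = E by rewrite adjM adjK.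
have TE : GRing.comm T E by exact: commrM.
have commTVk : T ^+ k * V ^+ k = 1 /\ V ^+ k * T ^+ k = 1.
  by rewrite -!exprMn_comm ?TV ?VT ?expr1n// /GRing.comm TV VT.
have [N [N1 VN]] := bop_bound (V ^+ k).
have N0 : 0 < N by exact: lt_le_trans N1.
(* From x = V^k A x, the norm of [x] is at most N |A x|. *)
have Elow x : N ^- 2 * hnorm x ^+ 2 <= rip (E x) x.
  rewrite rip_adjM mulrC ler_pdivrMr ?exprn_gt0// -exprMn ler_sqr ?nnegrE.
  - by rewrite mulrC; have := VN (A x); rewrite -bopME commTVk.2.
  - exact: hnorm_ge0.
  - by rewrite mulr_ge0 ?hnorm_ge0 ?ltW.
(* [E] is |A|^2, so the k-th root of |A| is the root of order 2k of [E]. *)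
have k20 : (0 < 2 * k)%N by rewrite muln_gt0.
have [|F [G [FF Fk FG GF FB]]] := positive_root _ k20 Elow EE.
  by rewrite invr_gt0 exprn_gt0.
have GG : adj G = G := adj_inverse FG GF FF.
have [U UE] : exists U, U = G * T by exists (G * T).
have TF : GRing.comm T F by exact: FB.
have TG : GRing.comm T G := comm_inverse FG GF TF.
have U'E : adj U = adj T * G by rewrite UE adjM GG.
have T'G : GRing.comm (adj T) G by rewrite -GG; exact: comm_adj.
have Uk : adj U ^+ k * U ^+ k = 1.
  rewrite U'E UE (exprMn_comm _ T'G) (exprMn_comm _ (commr_sym TG)).
  rewrite mulrA -[_ * G ^+ k * G ^+ k]mulrA -exprD addnn -mul2n.
  rewrite (commrX _ (commr_sym (commrX k (commr_sym T'G)))) -mulrA -adjX -/A -/E -Fk.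
  by rewrite -exprMn_comm ?GF ?expr1n// /GRing.comm GF FG.
pose Q := \sum_(j < k) adj U ^+ j * U ^+ j.
have QQ : adj Q = Q.
  by rewrite adj_sum; apply: eq_bigr => j _; rewrite adjM !adjX adjK.
(* Conjugation shifts the sum by one place; the new last term is 1 by [Uk] and replaces the lost
   first term. *)
have UQ : adj U * Q * U = Q.
  rewrite /Q mulr_sumr mulr_suml.
  under eq_bigr do rewrite mulrA -exprS -mulrA -exprSr.
  rewrite -(prednK k0) in Uk *.
  by rewrite big_ord_recr/= Uk [RHS]big_ord_recl expr0 mulr1 addrC.
(* The term [j = 0] is the identity and the others are nonnegative. *)
have Qlow x : 1 * hnorm x ^+ 2 <= rip (Q x) x.
  rewrite mul1r /Q bop_sumE rip_sum -(prednK k0) big_ord_recl expr0 mulr1 bop1E ripxx.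
  by rewrite lerDl sumr_ge0// => j _; rewrite -adjX rip_adjM sqr_ge0.
have [X [Y [XX X2 XY YX XB]]] := positive_root ltr01 (isT : (0 < 2)%N) Qlow QQ.
have YY : adj Y = Y := adj_inverse XY YX XX.
have PXY P : GRing.comm P T -> GRing.comm P (adj T) -> GRing.comm P F ->
    GRing.comm P X /\ GRing.comm P Y.
  move=> PT PT' PF; have PG := comm_inverse FG GF PF.
  have PX : GRing.comm P X.
    apply: XB; apply: commr_sum => j _; apply: commrM; apply: commrX.
      by rewrite U'E; apply: commrM.
    by rewrite UE; apply: commrM.
  by split=> //; apply: comm_inverse XY YX PX.
exists X, Y; split => //; last first.
  move=> P PT PT'; apply: PXY => //; apply: FB.
  by rewrite /E /A adjX; apply: commrM; exact: commrX.
have [FX FY] : GRing.comm F X /\ GRing.comm F Y.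
  apply: (PXY F (commr_sym TF) _ (commr_refl F)).
  by rewrite -[X in GRing.comm X _]FF; apply/comm_adj/commr_sym.
(* [W] is an isometry by [UQ], and [W'] is a right inverse of it, built from the inverse [V F] of
   [U]; hence [W] is unitary. *)
pose W := X * U * Y; pose W' := X * (V * F) * Y.
have FU : GRing.comm F U.
  by rewrite UE; apply: commrM; [rewrite /GRing.comm FG GF | exact/commr_sym].
have FW : GRing.comm F W by do 2!apply: commrM => //.
have W1 : adj W * W = 1.
  rewrite /W (adjM (X * U)) (adjM X) XX YY !mulrA -[Y * adj U * X * X]mulrA -expr2 X2.
  have -> : Y * adj U * Q * U * Y = Y * (adj U * Q * U) * Y by rewrite !mulrA.
  by rewrite UQ -X2 expr2 !mulrA YX mul1r XY.
have W2 : W * W' = 1.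
  rewrite /W /W' !mulrA -[X * U * Y * X]mulrA YX mulr1 UE.
  rewrite !mulrA -[X * G * T * V]mulrA TV mulr1 -[X * G * F]mulrA GF mulr1.
  exact: XY.
have W3 : W * adj W = 1 by rewrite -[adj W]mulr1 -W2 [adj W * _]mulrA W1 mul1r.
(* The factors commute, [F] is self-adjoint and [W] unitary, so the product is normal. *)
have XTY : X * T * Y = F * W.
  rewrite /W mulrA [F * (X * U)]mulrA FX -[X * F * U]mulrA UE [F * _]mulrA FG mul1r.
  by [].
have FW' : GRing.comm F (adj W) by rewrite -[F]FF; exact: comm_adj.
rewrite XTY adjM FF /GRing.comm -mulrA [W * _]mulrA W3 mul1r.
by rewrite FW [RHS]mulrA -[adj W * F * W]mulrA FW [adj W * _]mulrA W1 mul1r.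
Qed.

End PowerNormal.

(** * Normal powers of the Drazin inverse and the Drazin projection *)

Section PowerDNormal.
Context {R : realType} {H : hilbertType R}.
Implicit Types (T S P : bounded_op H) (p n m k : nat).

Lemma ring_drazinE p T S : drazin_spec p T S -> ring_drazin p T S.
Proof.
case=> _ ST SST TpS; split; [exact/bop_ext/ST | exact/bop_ext/SST |].
by apply: bop_ext => x; rewrite -exprSr bopME !bopXE TpS.
Qed.

Lemma adj_drazin p T S : ring_drazin p T S -> ring_drazin p (adj T) (adj S).
Proof.
case=> ST SST TpS; have TS := commr_sym ST; split; first exact: comm_adj.
  by rewrite -!adjM (commrM TS TS) SST.
have STp : GRing.comm S (T * T ^+ p) by apply: commrM => //; exact: commrX.
by rewrite -adjX -!adjM STp -exprS exprSr TpS.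
Qed.

Lemma is_adjointE T S : is_adjoint T S -> adj T = S.
Proof. by case=> _ TS; apply: adj_uniq => x y; exact: TS. Qed.

Lemma power_D_normal_pow n m T S p : power_D_normal n m T -> ring_drazin p T S ->
  GRing.comm (S ^+ (n * m)) (adj (S ^+ (n * m))).
Proof.
move=> [S' [Ts [[q /ring_drazinE S'q] /is_adjointE <- comm_nm]]] Sp.
have {q S' S'q comm_nm} SE : GRing.comm (S ^+ n) (adj T ^+ m).
  rewrite (drazin_unique Sp S'q); apply: bop_ext => x.
  by rewrite 2!bopME !bopXE comm_nm.
(* The adjoint of S^(nm) is the Drazin inverse of the nm-th power of [adj T], so commuting with the
   latter suffices. *)
have d := drazinX (n * m) (adj_drazin Sp).
rewrite adjX; apply: drazin_comm d _.
rewrite exprM mulnC exprM.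
by apply: commrX; apply: commr_sym; apply: commrX; apply: commr_sym.
Qed.

(** [G] kills the range of [1 - P], and by normality so does its adjoint; taking adjoints,
    [(1 - adj P) * G = 0]. Since [P = G * T ^+ k], this gives [P = adj P * P], which is
    self-adjoint. *)
Lemma drazin_proj_orthogonal T S p k : (0 < k)%N -> ring_drazin p T S ->
  GRing.comm (S ^+ k) (adj (S ^+ k)) -> adj (T * S) = T * S.
Proof.
move=> k0 [ST SST _] nG; set G := S ^+ k in nG; set P := T * S.
have SP : S * P = S by rewrite /P -ST mulrA SST.
have PP : P * P = P by rewrite {1}/P -mulrA SP.
have GP : G * P = G by rewrite /G -(prednK k0) exprSr -mulrA SP.
have PG : P = G * T ^+ k.
  rewrite -exprMn_comm// ST -/P -(prednK k0).
  by elim: k.-1 => [|j IH]; rewrite ?expr1// exprS -IH PP.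
have G0 : adj G * (1 - P) = 0.
  apply: bop_ext => x; apply: hnorm_eq0; rewrite bopME normal_hnorm//.
  by rewrite -bopME mulrBr mulr1 GP subrr hnorm0.
have {}G0 : (1 - adj P) * G = 0.
  by rewrite -[LHS]adjK adjM adjB adjK adj1 G0 adj0.
have P1 : P = adj P * P.
  by apply/subr0_eq; rewrite -{1}[P]mul1r -mulrBl {2}PG mulrA G0 mul0r.
by rewrite P1 adjM adjK -P1.
Qed.

Lemma closed_ker P : closed [set x | P x = 0].
Proof.
have cP : continuous P by apply/linear_bounded_continuous; exact: bop_bounded.
have -> : [set x | P x = 0] = P @^-1` [set 0] by [].
apply: closed_comp; first by move=> x _; exact: cP.
exact/accessible_closed_set1/hausdorff_accessible/norm_hausdorff.
Qed.

Lemma closed_subspace_ker P : closed_subspace [set x | P x = 0].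
Proof.
split; first exact: closed_ker.
  by rewrite /= linear0.
by move=> a x y /= Px Py; rewrite linearP Px Py scaler0 addr0.
Qed.

End PowerDNormal.

(** * Splitting of [H] by the Drazin projection, and the two similarities *)

Theorem theorem2p2 (R : realType) (H : hilbertType R)
  (infH : infinite_dimensional H) (n m : nat) (n_ge1 : (1 <= n)%N)
  (m_ge1 : (1 <= m)%N) (T : bounded_op H) (DN_T : power_D_normal n m T)
  (Td : bounded_op H) (Td_inv : drazin_inverse T Td)
  (p : nat) (p_index : drazin_index T p) :
  exists H1 H0 : set H,
    [/\ direct_sum_decomposition H1 H0,
        decomposes H1 H0 T,
        exists N : bounded_op H,
          [/\ decomposes H1 H0 N, normal_on H1 N, nilpotent_on H0 p N
            & similar_op T N]
      & exists M : bounded_op H, normal_op M /\ similar_op Td M].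
Proof.
(* By uniqueness [Td] satisfies the Drazin equations with the exponent [p], which becomes the order
   of nilpotency. *)
have {p_index Td_inv} d : ring_drazin p T Td.
  have [[S /ring_drazinE dS] _] := p_index; have [q /ring_drazinE dT] := Td_inv.
  by rewrite (drazin_unique dT dS).
have [ST SST TpS] := d.
have k0 : (0 < n * m)%N by rewrite muln_gt0 n_ge1.
have nG := power_D_normal_pow DN_T d.
set k := (n * m)%N in k0 nG.

have [P PE] : exists P : bounded_op H, P = T * Td by exists (T * Td).
have PP' : adj P = P by rewrite PE; exact: drazin_proj_orthogonal k0 d nG.
have SP : Td * P = Td by rewrite PE -ST mulrA SST.
have PP : P * P = P by rewrite {1}PE -mulrA SP PE.
have PS : GRing.comm P Td.
  by rewrite PE; apply/commr_sym/commrM => //; exact: commr_refl.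
have PT : GRing.comm P T.
  by rewrite PE; apply/commr_sym/commrM; [exact: commr_refl|exact/commr_sym].
have [C CE] : exists C : bounded_op H, C = 1 - P by exists (1 - P).
have PDC : P + C = 1 by rewrite CE addrC subrK.
have PC : P * C = 0 by rewrite CE mulrBr mulr1 PP subrr.
have CP : C * P = 0 by rewrite CE mulrBl mul1r PP subrr.
have CC : C * C = C by rewrite {2}CE mulrBr mulr1 CP subr0.
have SC : Td * C = 0 by rewrite CE mulrBr mulr1 SP subrr.
have CS : C * Td = 0 by rewrite CE mulrBl mul1r PS SP subrr.
have C_adj : adj C = C by rewrite CE adjB adj1 PP'.
have comm_PC : GRing.comm P C by rewrite /GRing.comm PC CP.
have comm_CS : GRing.comm C Td by rewrite /GRing.comm CS SC.
(* [T] on the range of [P], completed by the identity on the kernel, is invertible on all of [H];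
   this avoids operators on subspaces. *)
have [T1 T1E] : exists T1 : bounded_op H, T1 = T * P + C by exists (T * P + C).
have [V1 V1E] : exists V1 : bounded_op H, V1 = Td + C by exists (Td + C).
have TV : T1 * V1 = 1.
  rewrite T1E V1E mulrDl !mulrDr CC CS add0r.
  by rewrite -!mulrA PC mulr0 addr0 PS SP -PE.
have VT : V1 * T1 = 1.
  rewrite T1E V1E mulrDl !mulrDr CC SC addr0 -PT.
  by rewrite [C * _]mulrA CP mul0r add0r mulrA SP ST -PE.
have V1k j : (0 < j)%N -> V1 ^+ j = Td ^+ j + C.
  case: j => // j _; elim: j => [|j IH]; first by rewrite !expr1 V1E.
  have CSj : C * Td ^+ j.+1 = 0 by rewrite exprS mulrA CS mul0r.
  by rewrite exprS IH V1E mulrDl !mulrDr CC SC CSj addr0 add0r -exprS.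
have nV : GRing.comm (V1 ^+ k) (adj (V1 ^+ k)).
  rewrite V1k// adjD C_adj.
  have CSk : GRing.comm C (Td ^+ k) by exact: commrX.
  have CSk' : GRing.comm C (adj (Td ^+ k)) by rewrite -C_adj; exact: comm_adj.
  by apply: commrD; apply: commr_sym; apply: commrD => //; exact: commr_sym.
(* Applied to the inverse [V1] of [T1], whose k-th power is known to be normal; the normal operator
   obtained is [W], and its inverse [N1] is normal too. *)
have [X [Y [XY YX nW PXY]]] := power_normal_similar k0 VT TV nV.
have PV1 : GRing.comm P V1.
  by rewrite V1E; apply: commrD.
have PV1' : GRing.comm P (adj V1) by rewrite -PP'; exact: comm_adj.
have [PX PY] := PXY P PV1 PV1'.
have [W WE] : exists W : bounded_op H, W = X * V1 * Y by eexists.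
have [N1 N1E] : exists N1 : bounded_op H, N1 = X * T1 * Y by eexists.
rewrite -WE in nW.
have WN : W * N1 = 1.
  by rewrite WE N1E !mulrA -[_ * Y * X]mulrA YX mulr1 -[X * V1 * T1]mulrA VT mulr1.
have NW : N1 * W = 1.
  by rewrite WE N1E !mulrA -[_ * Y * X]mulrA YX mulr1 -[X * T1 * V1]mulrA TV mulr1.
have nN1 : GRing.comm N1 (adj N1).
  apply: (@comm_inverse _ (adj W)); rewrite -?adjM ?NW ?WN ?adj1//.
  by apply/commr_sym/(comm_inverse WN NW)/commr_sym.
have PN1 : GRing.comm P N1.
  rewrite N1E T1E; apply: commrM => //; apply: commrM => //; apply: commrD => //.
  by apply: commrM => //; exact: commr_refl.
have PN1' : GRing.comm P (adj N1) by rewrite -PP'; exact: comm_adj.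
have PW : GRing.comm P W by rewrite WE; do 2!apply: commrM => //.
have PW' : GRing.comm P (adj W) by rewrite -PP'; exact: comm_adj.
(* The conjugate of [T] itself; it agrees with the normal [N1] on the range of [P]. *)
pose N : bounded_op H := X * T * Y.
have PN : GRing.comm P N by do 2!apply: commrM => //.
have NP : N * P = N1 * P.
  have T1P : T1 * P = T * P by rewrite T1E mulrDl CP addr0 -mulrA PP.
  by rewrite N1E /N -!mulrA -PY (mulrA T) (mulrA T1) T1P.
(* The range of the idempotent [P] is also a kernel, hence closed. *)
have ker1 : [set x | P x = x] = [set x | C x = 0].
  apply/seteqP; split=> x /=; rewrite CE bopBE bop1E; first by move=> ->; rewrite subrr.
  by move=> /eqP; rewrite subr_eq0 => /eqP.
have inv1 (B : bounded_op H) : GRing.comm P B -> Defs.invariant [set x | P x = x] B.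
  by move=> PB x /= Px; rewrite -bopME PB bopME Px.
have inv0 (B : bounded_op H) : GRing.comm P B -> Defs.invariant [set x | P x = 0] B.
  by move=> PB x /= Px; rewrite -bopME PB bopME Px linear0.
exists [set x | P x = x], [set x | P x = 0]; split.
- split; [by rewrite ker1; exact: closed_subspace_ker|exact: closed_subspace_ker| |].
    apply/seteqP; split=> x /= => [[-> ->] //|->]; by rewrite linear0.
  move=> x; exists (P x), (C x); split => /=.
  + by rewrite -bopME PP.
  + by rewrite -bopME PC.
  + by rewrite -bopDE PDC.
- by split; [exact: inv1|exact: inv0].
- exists N; split.
  + by split; [exact: inv1|exact: inv0].
  + have NE x : P x = x -> N x = N1 x by move=> Px; rewrite -Px -!bopME NP.
    (* The adjoint of [N1] preserves the range of [P], so it serves as the adjoint of the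
       restriction of [N]. *)
    exists (adj N1); split; first split; first exact: inv1.
      by move=> x y Px _; rewrite NE// adjP.
    move=> x Px; rewrite !NE//; last exact: (inv1 _ PN1').
    by rewrite -!bopME nN1.
  + move=> x Px; rewrite -bopXE.
    have -> : N ^+ p = X * T ^+ p * Y.
      elim: p {d TpS} => [|q IH]; first by rewrite !expr0 mulr1 XY.
      by rewrite exprSr IH /N !mulrA -[_ * Y * X]mulrA YX mulr1 (exprSr T) mulrA.
    (* [T ^+ p = T ^+ p * P] and [P] commutes with [Y], so [N ^+ p] vanishes on the kernel of
       [P]. *)
    rewrite -TpS -[_ * T * Td]mulrA -PE -mulrA -[_ * P * Y]mulrA PY.
    by rewrite !mulrA bopME Px linear0.
  + exists X, Y; split => x; rewrite -!bopME ?XY ?YX//.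
    by rewrite /N -mulrA YX mulr1.
exists (X * Td * Y); split.
  (* This operator is normal as the product of the normal [W] and the self-adjoint [P], which
     commute. *)
  have ME : X * Td * Y = W * P.
    have <- : V1 * P = Td by rewrite V1E mulrDl CP addr0 SP.
    by rewrite WE mulrA -[_ * P * Y]mulrA PY mulrA.
  have nM : GRing.comm (W * P) (adj (W * P)).
    by rewrite adjM PP'; apply: commrM; apply: commr_sym; apply: commrM => //;
      exact: commr_sym.
  exists (adj (X * Td * Y)); split; first by split=> // x y _ _; exact: adjP.
  by move=> x; rewrite -!bopME ME nM.
exists X, Y; split => x; rewrite -!bopME ?XY ?YX//.
by rewrite -mulrA YX mulr1.
Qed.
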